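(* Let $H$ be a linear forest containing $P_4$ as a subgraph. Then for all sufficiently large $n$, every $G\in SPEX_P(n,K_2+H)$ is isomorphic to $K_2+H'$ for some $H$-maximal linear forest $H'$.
   Context: All graphs are finite and simple. A linear forest is a disjoint union of paths and isolated vertices. A graph is $F$-free if it has no subgraph isomorphic to $F$. The spectral radius of a graph is the largest eigenvalue of its adjacency matrix. $SPEX_P(n,F)$ denotes the set of $n$-vertex $F$-free planar graphs whose spectral radius is maximum among all $n$-vertex $F$-free planar graphs. $K_m$, $P_m$ denote the complete graph and path on $m$ vertices. The join $G_1+G_2$ of vertex-disjoint graphs is obtained from $G_1\cup G_2$ by adding all edges between $V(G_1)$ and $V(G_2)$. A linear forest $H'$ on $m$ vertices is $H$-maximal if $H'$ is $H$-free and every linear forest on $m$ vertices containing $H'$ as a proper subgraph contains $H$. *)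

(* Defs.v *)
From HB Require Import structures.
From mathcomp Require Import all_boot all_order all_algebra.
From mathcomp Require Import boolp classical_sets set_interval reals.
From mathcomp Require Import topology normedtype.

Set Implicit Arguments.
Unset Strict Implicit.
Unset Printing Implicit Defensive.

Import Order.TTheory GRing.Theory Num.Theory.
Import numFieldNormedType.Exports.

Local Open Scope classical_set_scope.
Local Open Scope ring_scope.

Record sgraph := SGraph {
  vertex :> finType;
  adj : rel vertex;
  adj_sym : symmetric adj;
  adj_irrefl : irreflexive adj }.

Definition is_embedding (F G : sgraph) (f : F -> G) : Prop :=
  injective f /\ forall x y, adj x y -> adj (f x) (f y).

Definition is_isomorphism (F G : sgraph) (f : F -> G) : Prop :=
  bijective f /\ forall x y, adj (f x) (f y) = adj x y.

Definition isomorphic (F G : sgraph) : Prop :=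
  exists f : F -> G, is_isomorphism f.

(* [F] occurs in [G] as a (not necessarily induced) subgraph. *)
Definition contains (G F : sgraph) : Prop :=
  exists f : F -> G, is_embedding f.

(* The copy of [F] is not all of [G]: it misses a vertex or an edge. *)
Definition contains_proper (G F : sgraph) : Prop :=
  exists f : F -> G, is_embedding f /\ ~ is_isomorphism f.

Definition free (F G : sgraph) : Prop := ~ contains G F.

Section Complete.
Variable m : nat.
Definition complete_adj : rel 'I_m := fun i j => i != j.
Fact complete_sym : symmetric complete_adj.
Proof. by move=> i j; rewrite /complete_adj eq_sym. Qed.
Fact complete_irrefl : irreflexive complete_adj.
Proof. by move=> i; rewrite /complete_adj eqxx. Qed.
Definition complete_graph := SGraph complete_sym complete_irrefl.
End Complete.

Section Path.
Variable m : nat.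
Definition path_adj : rel 'I_m :=
  fun i j => (i.+1 == j :> nat) || (j.+1 == i :> nat).
Fact path_sym : symmetric path_adj.
Proof. by move=> i j; rewrite /path_adj orbC. Qed.
Fact path_irrefl : irreflexive path_adj.
Proof. by move=> i; rewrite /path_adj orbb gtn_eqF. Qed.
Definition path_graph := SGraph path_sym path_irrefl.
End Path.

Section Join.
Variables G1 G2 : sgraph.
Definition join_adj : rel (G1 + G2)%type := fun u v =>
  match u, v with
  | inl x, inl y => adj x y
  | inr x, inr y => adj x y
  | _, _ => true
  end.
Fact join_sym : symmetric join_adj.
Proof. by move=> [x|x] [y|y] //=; rewrite adj_sym. Qed.
Fact join_irrefl : irreflexive join_adj.
Proof. by move=> [x|x] /=; rewrite adj_irrefl. Qed.
Definition join := SGraph join_sym join_irrefl.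
End Join.

Section DisjointUnion.
Variables (I : finType) (G : I -> sgraph).
Definition dunion_adj : rel {i : I & G i} := fun u v =>
  (tag u == tag v) && adj (tagged u) (tagged_as u v).
Fact dunion_sym : symmetric dunion_adj.
Proof.
move=> [i x] [j y]; rewrite /dunion_adj /= eq_sym.
case: eqVneq => //= eq_ji; case: i / eq_ji x => x.
by rewrite !tagged_asE adj_sym.
Qed.
Fact dunion_irrefl : irreflexive dunion_adj.
Proof. by move=> [i x]; rewrite /dunion_adj tagged_asE adj_irrefl andbF. Qed.
Definition dunion := SGraph dunion_sym dunion_irrefl.
End DisjointUnion.

(* Isolated vertices are the components [path_graph 1]. *)
Definition linear_forest (G : sgraph) : Prop :=
  exists (k : nat) (m : 'I_k -> nat),
    isomorphic G (dunion (fun i => path_graph (m i))).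

Definition maximal_linear_forest (H H' : sgraph) : Prop :=
  [/\ linear_forest H', free H H' &
      forall L : sgraph, linear_forest L -> #|L| = #|H'| ->
        contains_proper L H' -> contains L H].

Section Planarity.
Variable R : realType.

Definition is_arc (a b : R * R) (A : set (R * R)) : Prop :=
  exists g : R -> R * R,
    [/\ {within `[0, 1], continuous g}, {in `[0, 1] &, injective g},
        g 0 = a, g 1 = b & A = g @` `[0, 1]].

(* [A e] is the arc drawn for the edge [e], an unordered pair of vertices;
   the values of [A] outside the edge set are irrelevant. *)
Definition planar (G : sgraph) : Prop :=
  exists (p : G -> R * R) (A : {set G} -> set (R * R)),
    [/\ injective p,
        forall x y : G, adj x y -> is_arc (p x) (p y) (A [set x; y]%SET),
        forall x y z : G, adj x y -> A [set x; y]%SET (p z) ->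
          z \in [set x; y]%SET &
        forall x y u v : G, adj x y -> adj u v ->
          [set x; y]%SET != [set u; v]%SET ->
          A [set x; y]%SET `&` A [set u; v]%SET `<=` range p].

End Planarity.

Section Spectrum.
Variables (R : realType) (G : sgraph).

Definition adjacency_matrix : 'M[R]_#|G| :=
  \matrix_(i, j) (adj (enum_val i) (enum_val j))%:R.

(* The set of eigenvalues is finite, and nonempty if [G] has a vertex, so that
   its supremum is the largest eigenvalue. *)
Definition spectral_radius : R := sup [set a | eigenvalue adjacency_matrix a].

End Spectrum.

Definition SPEX_P (R : realType) (n : nat) (F G : sgraph) : Prop :=
  let admissible (G0 : sgraph) := [/\ #|G0| = n, planar R G0 & free F G0] in
  admissible G /\
  forall G0 : sgraph, admissible G0 ->
    spectral_radius R G0 <= spectral_radius R G.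

(* Main.v *)
(* Only three facts about planarity are used: a planar graph has no K_{3,3}
   subgraph and no K_5 minor, and the join of K_2 with a path has a straight-line
   drawing. The first two follow from a parity argument which ignores crossings
   of adjacent edges: for disjoint edges e and f, the differences of points of e
   and f form a loop of nonzero vectors around e x f, and the winding parities of
   these loops, summed over all pairs of disjoint edges of K_5 or K_{3,3}, are
   forced to be odd although each of them vanishes. By Mader's contraction argument
   the absence of a K_5 minor bounds all average degrees.

   Let x be a nonnegative eigenvector for the spectral radius rho, with maximal
   entry 1 at u. Comparison with K_2 joined to isolated vertices gives
   rho^2 >= 2(n - 2). Counting walks of length two, where all but boundedly many
   vertices have at most two neighbours of large degree by K_{3,3}-freeness, yields
   a second vertex v with x_v close to 1 such that u and v are joined to almost all
   vertices, and all other entries of x are small. Rayleigh quotients at x then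
   compare G with explicit graphs K_2 + L, L a linear forest, which are planar by
   their drawing: with copies of P_3 to show that u and v are adjacent, and with
   the subgraph induced on the common neighbours, padded by isolated vertices, to
   show that every vertex is a common neighbour. The remaining graph has maximum
   degree 2 by K_{3,3}-freeness and no cycle by the absence of a K_5 minor, hence is
   a linear forest, and it is H-maximal because additional edges increase rho. *)
From HB Require Import structures.
Require Import Defs.
From mathcomp Require Import all_boot all_order all_algebra.
From mathcomp Require Import reals.
From mathcomp Require Import ring lra zify.

Set Implicit Arguments.
Unset Strict Implicit.
Unset Printing Implicit Defensive.

Import Order.TTheory GRing.Theory Num.Theory.

(** * Minors *)

(** Edges may be drawn as arbitrary continuous arcs, and no Jordan curve theorem is invoked. Arcs
    are replaced by finite chains of points whose steps are small against the distance of disjoint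
    edges, which takes only connectedness and compactness; winding parities become finite sums of
    bits over small cells. Ignoring adjacent edges has a second use. A K_5 minor need not contain a
    subdivision of K_5, but a path from v_i to v_j inside the union of the i-th and j-th branch sets
    meets only paths that share an index with it, and that is all the parity argument asks for. All
    comparison graphs live on the vertex type of G, as relations [hub_rel u v l], so that the one
    eigenvector of G tests each of them. Connectedness of G is not known beforehand, hence the
    eigenvector is only nonnegative; positivity is recovered at the end from adjacency to u, whose
    entry is 1. The constant 32 is 2^5, an average degree that forces a K_5 minor. The errors of the
    walk counting add up to a few thousand times [eta * n], which [eta] = 10^-7 makes harmless. *)

Section Minors.
Variable T : finType.
Implicit Types (e : rel T) (S B C N : {set T}).

Definition restr e B : rel T := fun a b => [&& a \in B, b \in B & e a b].

Definition connected_set e B :=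
  [forall x in B, forall y in B, connect (restr e B) x y].

Definition touching e B C := [exists x in B, exists y in C, e x y].

Definition minor_model e (Bs : seq {set T}) :=
  all (fun B => (B != set0) && connected_set e B) Bs &&
  pairwise (fun B C => [disjoint B & C] && touching e B C) Bs.

Definition nbr_in e S x := [set y in S | e x y].

Definition degree_sum e S := \sum_(x in S) #|nbr_in e S x|.

Lemma connected_setP e B :
  reflect (forall x y, x \in B -> y \in B -> connect (restr e B) x y) (connected_set e B).
Proof.
apply: (iffP forall_inP) => h x; last by move=> xB; apply/forall_inP => y yB; exact: h.
by move=> y xB yB; move/forall_inP: (h x xB); apply.
Qed.

Lemma touchingP e B C :
  reflect (exists x y, [/\ x \in B, y \in C & e x y]) (touching e B C).
Proof.
apply: (iffP exists_inP) => [[x xB /exists_inP[y yC xy]]|[x [y [xB yC xy]]]].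
  by exists x, y.
by exists x => //; apply/exists_inP; exists y.
Qed.

Section Contraction.
Variables (e : rel T) (x y : T).
Hypotheses (e_sym : symmetric e) (e_irr : irreflexive e) (xy : e x y).

(** The vertex [y] stays in the type with its old edges and is discarded only by passing to
    [S :\ y]; thus the induction in [mader] never changes the vertex type. *)
Definition contract : rel T := fun a b =>
  (a != b) && [|| e a b, (a == x) && e y b | (b == x) && e y a].

Lemma contract_sym : symmetric contract.
Proof. by move=> a b; rewrite /contract eq_sym e_sym; congr andb; congr orb; rewrite orbC. Qed.

Lemma contract_irr : irreflexive contract.
Proof. by move=> a; rewrite /contract eqxx. Qed.

Lemma sub_contract a b : e a b -> contract a b.
Proof. by move=> ab; rewrite /contract ab andbT; apply: contraTneq ab => ->; rewrite e_irr. Qed.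

Definition uncontract B := if x \in B then y |: B else B.

Lemma sub_uncontract B : B \subset uncontract B.
Proof. by rewrite /uncontract; case: ifP => // _; exact: subsetUr. Qed.

Lemma connected_uncontract B : y \notin B ->
  connected_set contract B -> connected_set e (uncontract B).
Proof.
move=> yB /connected_setP cB; apply/connected_setP.
have sub a b : restr contract B a b -> connect (restr e (uncontract B)) a b.
  move=> /and3P[aB bB /andP[ab /or3P[eab|/andP[/eqP ax yb]|/andP[/eqP bx ya]]]].
  - apply: connect1; rewrite /restr eab andbT.
    by rewrite !(subsetP (sub_uncontract B)).
  - subst a; apply: (connect_trans (y := y)); apply: connect1; rewrite /restr /uncontract aB.
      by rewrite !inE aB eqxx orbT.
    by rewrite !inE bB eqxx orbT.
  - subst b; apply: (connect_trans (y := y)); apply: connect1; rewrite /restr /uncontract bB.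
      by rewrite !inE aB eqxx orbT /= e_sym.
    by rewrite !inE bB eqxx orbT /= e_sym.
have csub := connect_sub sub.
rewrite /uncontract; case: ifPn => [xB|xB] a b; last first.
  by move=> aB bB; move: (csub _ _ (cB a b aB bB)); rewrite /uncontract (negbTE xB).
have csym : connect_sym (restr e (y |: B)).
  by apply: sym_connect_sym => c d; rewrite /restr e_sym; case: (c \in _); case: (d \in _).
have to_x c : c \in y |: B -> connect (restr e (y |: B)) c x.
  move=> /setU1P[->|cB']; first by apply: connect1; rewrite /restr !inE eqxx xB orbT e_sym.
  by move: (csub _ _ (cB c x cB' xB)); rewrite /uncontract xB.
by move=> aB bB; apply: connect_trans (to_x a aB) _; rewrite csym; exact: to_x.
Qed.

Lemma touching_uncontract B C : y \notin B -> y \notin C -> touching contract B C ->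
  touching e (uncontract B) (uncontract C).
Proof.
move=> yB yC /touchingP[a [b [aB bC /andP[ab]]]] h; apply/touchingP.
have sB := subsetP (sub_uncontract B); have sC := subsetP (sub_uncontract C).
case/or3P: h => [eab|/andP[/eqP ax yb]|/andP[/eqP bx ya]].
- by exists a, b; rewrite sB ?sC.
- by exists y, b; rewrite sC // yb /uncontract -{1}ax aB !inE eqxx.
- by exists a, y; rewrite sB // e_sym ya /uncontract -{1}bx bC !inE eqxx.
Qed.

Lemma disjoint_uncontract B C : y \notin B -> y \notin C ->
  [disjoint B & C] -> [disjoint uncontract B & uncontract C].
Proof.
move=> yB yC dBC; rewrite /uncontract.
case: ifPn => xB; case: ifPn => xC //.
- by rewrite (disjointFr dBC xB) in xC.
- rewrite disjoint_subset; apply/subsetP => z /setU1P[->|zB]; rewrite inE //.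
  by rewrite (disjointFr dBC).
- rewrite disjoint_subset; apply/subsetP => z zB; rewrite !inE negb_or (disjointFr dBC) //.
  by rewrite andbT; apply: contraNneq yB => <-.
Qed.

Lemma model_uncontract Bs : all (fun B => y \notin B) Bs ->
  minor_model contract Bs -> minor_model e [seq uncontract B | B <- Bs].
Proof.
move=> yBs' /andP[/allP h1 h2]; have /allP yBs := yBs'; apply/andP; split.
  rewrite all_map; apply/allP => B BBs /=; have /andP[B0 cB] := h1 _ BBs.
  rewrite connected_uncontract ?yBs // andbT.
  apply: contraNneq B0 => B0; move: (sub_uncontract B); rewrite B0 subset0. by [].
rewrite pairwise_map; apply: (sub_in_pairwise (P := [pred B : {set T} | y \notin B]) _ yBs'
  h2) => B C yB yC /=.
by move=> /andP[dBC tBC]; rewrite disjoint_uncontract ?touching_uncontract.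
Qed.

(** The contraction destroys the edge [xy] and one of two parallel edges at each common neighbour,
    and a degree sum counts every edge twice. *)
Lemma degree_sum_contract S : x \in S -> y \in S ->
  (degree_sum e S <= degree_sum contract (S :\ y) + 2 * #|nbr_in e S x :&: nbr_in e S y|.+1)%N.
Proof.
move=> xS yS; set K := _ :&: _.
have yx : y != x by apply: contraTneq xy => ->; rewrite e_irr.
have xSy : x \in S :\ y by rewrite !inE eq_sym yx.
rewrite /degree_sum (bigD1 y) //= (bigD1 (P := mem (S :\ y)) x) //=.
rewrite (eq_bigl (mem (S :\ y))); last by move=> a; rewrite !inE andbC.
rewrite (bigD1 (P := mem (S :\ y)) x) //=.
have hx : (#|nbr_in e S y| + #|nbr_in e S x| <= #|nbr_in contract (S :\ y) x| + #|K| + 2)%N.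
  rewrite -cardsUI [nbr_in e S y :&: _]setIC -/K.
  have : nbr_in e S y :|: nbr_in e S x \subset nbr_in contract (S :\ y) x :|: [set x; y].
    apply/subsetP => z; rewrite !inE /contract eqxx /= (eq_sym x z).
    by case: (z == x); case: (z == y); case: (z \in S); case: (e x z); case: (e y z).
  move=> /subset_leq_card h.
  have := leq_of_leqif (leq_card_setU (nbr_in contract (S :\ y) x) [set x; y]).
  by rewrite cards2 eq_sym yx; lia.
have ha : (\sum_(a in S :\ y | a != x) #|nbr_in e S a| <=
    \sum_(a in S :\ y | a != x) #|nbr_in contract (S :\ y) a| + #|K|)%N.
  have -> : #|K| = (\sum_(a in S :\ y | a != x) (a \in K))%N.
    rewrite -sum1_card big_mkcond [RHS]big_mkcond; apply: eq_bigr => a _.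
    rewrite !inE; case: (eqVneq a y) => [->|_]; first by rewrite e_irr !andbF.
    case: (eqVneq a x) => [->|_]; first by rewrite e_irr !andbF.
    by rewrite !andbT /=; case: (a \in S).
  rewrite -big_split /=; apply: leq_sum => a /andP[/setD1P[ay aS] ax].
  have sub : nbr_in e S a :\ y \subset nbr_in contract (S :\ y) a.
    apply/subsetP => z; rewrite !inE => /and3P[-> -> az] /=; exact: sub_contract.
  have cN := cardsD1 y (nbr_in e S a); rewrite [y \in _]inE yS /= in cN; rewrite cN.
  have [eay|eay] := boolP (e a y); last first.
    by rewrite add0n; apply: leq_trans (subset_leq_card sub) (leq_addr _ _).
  have [eax|eax] := boolP (e a x).
    have -> : a \in K by rewrite !inE aS [e x a]e_sym eax e_sym eay.
    by rewrite add1n addn1 ltnS; exact: subset_leq_card.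
  have sub' : x |: (nbr_in e S a :\ y) \subset nbr_in contract (S :\ y) a.
    rewrite subUset sub andbT sub1set !inE eq_sym yx xS /contract ax eqxx.
    by rewrite [e y a]e_sym eay !orbT.
  apply: leq_trans (leq_addr _ _); apply: leq_trans (subset_leq_card sub').
  by rewrite cardsU1 !inE (negbTE eax) !andbF.
lia.
Qed.

End Contraction.

(* Mader: contract edges with few common neighbours until every edge lies in
   many triangles; the neighbourhood of a vertex then has large minimum degree. *)
Lemma mader r e S : symmetric e -> irreflexive e -> S != set0 ->
  (2 ^ r * #|S| <= degree_sum e S)%N ->
  exists Bs, [/\ size Bs = r, minor_model e Bs & all (fun B => B \subset S) Bs].
Proof.
elim: r e S => [|r IHr] e S; first by exists [::].
have [m] := ubnP #|S|; elim: m e S => // m IHm e S; rewrite ltnS => Sm e_sym e_irr S0 hS.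
have [/existsP[x /existsP[y /and4P[xS yS xy few]]]|none] :=
  boolP [exists x, exists y, [&& x \in S, y \in S, e x y &
     (#|nbr_in e S x :&: nbr_in e S y| < 2 ^ r)%N]].
  have yx : y != x by apply: contraTneq xy => ->; rewrite e_irr.
  have cS := cardsD1 y S; rewrite yS in cS.
  have [|||||Bs [sBs mBs BS]] := IHm (contract e x y) (S :\ y).
  - by lia.
  - exact: contract_sym.
  - exact: contract_irr.
  - by apply/set0Pn; exists x; rewrite !inE eq_sym yx.
  (* Fewer than [2 ^ r] common neighbours: the degree sum drops by at most [2 * 2 ^ r], which is
     what one vertex less allows. *)
  - by have := degree_sum_contract e_sym e_irr xy xS yS; rewrite expnS in hS *; nia.
  exists [seq uncontract x y B | B <- Bs]; split; first by rewrite size_map.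
    apply: model_uncontract => //; apply/allP => B /(allP BS) /subsetP sB.
    by apply/negP => /sB; rewrite !inE eqxx.
  rewrite all_map; apply/allP => B /(allP BS) /subsetP sB /=; apply/subsetP => z.
  rewrite /uncontract; case: ifP => _ => [/setU1P[->//|]|] => /sB; by rewrite !inE => /andP[].
have [x xS x0] : exists2 x, x \in S & nbr_in e S x != set0.
  apply/exists_inP; rewrite -negb_forall_in; apply: contraL hS => /forall_inP h.
  rewrite -ltnNge /degree_sum big1 ?muln_gt0 ?expn_gt0 ?card_gt0 ?S0 // => x xS.
  by move/eqP: (h x xS) => ->; rewrite cards0.
have [|Bs [sBs mBs BS]] := IHr e (nbr_in e S x) e_sym e_irr x0.
  rewrite mulnC -sum_nat_const; apply: leq_sum => y; rewrite inE => /andP[yS xy].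
  move: none; rewrite negb_exists => /forallP/(_ x); rewrite negb_exists => /forallP/(_ y).
  rewrite xS yS xy /= -leqNgt => h; apply: leq_trans h _; apply: subset_leq_card.
  by apply/subsetP => z; rewrite !inE => /andP[/andP[-> ->] /andP[_ ->]].
exists ([set x] :: Bs); split; first by rewrite /= sBs.
  case/andP: mBs => h1 h2; rewrite /minor_model /= h1 h2 !andbT.
  apply/andP; split.
    apply/andP; split; first by apply/set0Pn; exists x; rewrite inE.
    by apply/connected_setP => a b /set1P -> /set1P ->; exact: connect0.
  apply/allP => B BBs; have /andP[/set0Pn[b bB] _] := allP h1 _ BBs.
  have sB := subsetP (allP BS _ BBs).
  apply/andP; split.
    rewrite disjoints1; apply/negP => /sB; rewrite inE e_irr andbF. by [].
  by apply/touchingP; exists x, b; rewrite inE eqxx bB; have := sB _ bB; rewrite inE => /andP[].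
rewrite /= sub1set xS; apply/allP => B /(allP BS) sB; apply: subset_trans sB _.
by apply/subsetP => z; rewrite inE => /andP[].
Qed.

End Minors.

(** * Linear forests *)

Section LinearForests.

Definition consecutive (i j : nat) := (i.+1 == j) || (j.+1 == i).

Lemma consecutive_sym : symmetric consecutive.
Proof. by move=> i j; rewrite /consecutive orbC. Qed.

Section Decomposition.
Variables (T : finType) (e : rel T).
Hypotheses (e_sym : symmetric e) (e_irr : irreflexive e).
Hypothesis e_deg : forall x, (#|[set y | e x y]| <= 2)%N.
(** The bound is 3 because [cycle] also accepts the two ends of a single edge, walked back and
    forth. *)
Hypothesis e_acyclic : forall s, uniq s -> cycle e s -> (size s < 3)%N.

Lemma longest_path (S : {set T}) : S != set0 ->
  exists p : seq T, [/\ p != [::], uniq p, sorted e p, {subset p <= S} &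
    forall q, uniq q -> sorted e q -> {subset q <= S} -> (size q <= size p)%N].
Proof.
move=> /set0Pn[x xS].
pose P m := [exists p : m.-tuple T, [&& uniq p, sorted e p & all [in S] p]].
have exP : exists m, P m by exists 1; apply/existsP; exists [tuple x]; rewrite /= xS.
have ubP m : P m -> (m <= #|T|)%N.
  move=> /existsP[p /and3P[up _ _]]; rewrite -(size_tuple p).
  by rewrite cardE; apply: uniq_leq_size => // y _; rewrite mem_enum.
case: (ex_maxnP exP ubP) => m /existsP[p /and3P[up sp /allP pS]] maxm.
have maxp q : uniq q -> sorted e q -> {subset q <= S} -> (size q <= size p)%N.
  move=> uq sq /allP qS; rewrite size_tuple; apply: maxm; apply/existsP.
  by exists (in_tuple q); rewrite /= uq sq qS.
exists p; split=> //; rewrite -size_eq0 -lt0n.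
have := maxp [:: x] isT isT; apply.
by move=> y; rewrite inE => /eqP ->.
Qed.

(** A chord would close a cycle, a further neighbour of an end vertex would lengthen the path, and a
    further neighbour of an interior vertex would give it degree 3. So a longest path is an induced
    path and a whole component. *)
Lemma longest_path_component (S : {set T}) (p : seq T) :
  (forall x y, x \in S -> e x y -> y \in S) ->
  uniq p -> sorted e p -> {subset p <= S} ->
  (forall q, uniq q -> sorted e q -> {subset q <= S} -> (size q <= size p)%N) ->
  forall x y, x \in p -> e x y = (y \in p) && consecutive (index x p) (index y p).
Proof.
move=> S_closed up sp pS maxp x y xp.
have nx := nth_index x xp; set i := index x p in nx *.
have ip : (i < size p)%N by rewrite index_mem.
have step k : (k.+1 < size p)%N -> e (nth x p k) (nth x p k.+1).
  by move=> kp; have /(sortedP x)/(_ k kp) := sp.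
have no_chord k j : (k.+1 < j < size p)%N -> ~~ e (nth x p k) (nth x p j).
  move=> /andP[kj jp]; apply/negP => ekj.
  pose c := drop k (take j.+1 p).
  have szc : size c = (j.+1 - k)%N by rewrite size_drop size_takel.
  have := @e_acyclic c; rewrite szc drop_uniq ?take_uniq // => /(_ isT).
  suff -> : cycle e c by move=> /(_ isT); lia.
  have sc : sorted e c by apply: drop_sorted; exact: take_sorted.
  have nthc n : (n < size c)%N -> nth x c n = nth x p (k + n).
    by rewrite szc => nc; rewrite nth_drop nth_take //; lia.
  have hc : nth x c 0 = nth x p k by rewrite nthc ?addn0 // szc; lia.
  have lc : last x c = nth x p j.
    by rewrite -nth_last nthc szc; [congr nth; lia|lia].
  case: c sc hc lc {szc nthc} => //= z c sc zk lc.
  by rewrite rcons_path sc lc zk e_sym.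
have [yp|yp] /= := boolP (y \in p); last first.
  apply/negP => exy; have yS := S_closed _ _ (pS _ xp) exy.
  have [i0|i0] := posnP i.
    have := maxp (y :: p); rewrite /= yp up ltnn => /(_ isT) H.
    suff : false by []. apply: H.
      have hp : nth x p 0 = x by rewrite -[in RHS]nx i0.
      by case: (p) sp hp => //= z p' -> ->; rewrite e_sym exy.
    by move=> z /predU1P[->|/pS].
  have [il|il] := eqVneq i.+1 (size p).
    have := maxp (rcons p y); rewrite rcons_uniq yp up size_rcons ltnn => /(_ isT) H.
    suff : false by []. apply: H.
      have -> : sorted e (rcons p y) = sorted e p && e (last x p) y.
        by case: (p) xp => // z p' _; rewrite /= rcons_path.
      by rewrite sp -nth_last -il /= nx exy.
    by move=> z; rewrite mem_rcons => /predU1P[->|/pS].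
  have := e_deg x.
  have i1 : (i.+1 < size p)%N by lia.
  have ne k : (k < size p)%N -> y != nth x p k by move=> kp; apply: contraNneq yp => ->;
    exact: mem_nth.
  have uniq3 : uniq [:: y; nth x p i.-1; nth x p i.+1].
    rewrite /= !inE (nth_uniq x (_ : (i.-1 < size p)%N) i1 up); last by lia.
    by rewrite negb_or !ne //=; [lia|exact: leq_ltn_trans (leq_pred _) ip].
  have sub3 : {subset [:: y; nth x p i.-1; nth x p i.+1] <= enum [set z | e x z]}.
    move=> z; rewrite mem_enum !inE => /or3P[]/eqP-> //.
      by have := step i.-1; rewrite prednK // nx e_sym; apply.
    by have := step i i1; rewrite nx.
  by have := uniq_leq_size uniq3 sub3; rewrite -cardE /=; lia.
have ny := nth_index x yp; set j := index y p in ny *.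
have jp : (j < size p)%N by rewrite index_mem.
rewrite /consecutive; have [ij|ji|ij] := ltngtP i j.
- rewrite [_.+1 == i]gtn_eqF ?orbF; last by lia.
  have [ij1|ij1] := eqVneq i.+1 j; first by rewrite -nx -ny -ij1 step ?ij1.
  by rewrite -nx -ny; apply/negbTE/no_chord; lia.
- rewrite [_.+1 == j]gtn_eqF /=; last by lia.
  have [ij1|ij1] := eqVneq j.+1 i; first by rewrite e_sym -nx -ny -ij1 step ?ij1.
  by rewrite e_sym -nx -ny; apply/negbTE/no_chord; lia.
- by rewrite -nx -ny ij e_irr; lia.
Qed.

Definition path_layout (ss : seq (seq T)) :=
  forall s, s \in ss -> s != [::] /\
    forall x y, x \in s -> e x y = (y \in s) && consecutive (index x s) (index y s).

Lemma path_decomposition : exists ss : seq (seq T),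
  [/\ uniq (flatten ss), forall x, x \in flatten ss & path_layout ss].
Proof.
suff H n (S : {set T}) : (#|S| < n)%N -> (forall x y, x \in S -> e x y -> y \in S) ->
    exists ss : seq (seq T), [/\ uniq (flatten ss), flatten ss =i S & path_layout ss].
  have [//|//|ss [u a l]] := H #|T|.+1 [set: T]; first by rewrite cardsT.
  by exists ss; split => // x; rewrite a inE.
elim: n S => // n IH S Sn S_closed.
have [->|S0] := eqVneq S set0.
  by exists [::]; split => // x; rewrite inE.
have [p [p0 up sp pS maxp]] := longest_path S0.
have comp := longest_path_component S_closed up sp pS maxp.
have [||ss [uss ssS lss]] := IH (S :\: [set x in p]).
- rewrite ltnS in Sn; apply: leq_trans Sn; apply: proper_card; apply/properP; split;
  first exact: subsetDl.
  case: p p0 pS {up sp maxp comp} => // z p _ pS.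
  by exists z; rewrite ?pS ?inE ?eqxx.
- move=> x y; rewrite !inE => /andP[xp xS] xy; rewrite (S_closed x) // andbT.
  by apply: contra xp => yp; move: xy; rewrite e_sym comp // => /andP[].
exists (p :: ss); split.
- rewrite /= cat_uniq up uss andbT /=; apply/hasPn => x; rewrite ssS !inE.
  by case/andP.
- move=> x; rewrite /= mem_cat ssS !inE.
  by have [/pS ->|_] := boolP (x \in p).
- by move=> s; rewrite inE => /predU1P[->|/lss].
Qed.

(** The paths are laid end to end, which places the forest inside one long path. Ends of successive
    paths become consecutive without being adjacent, hence a mere implication; the drawing needs no
    more. *)
Lemma index_decomposition : exists idx : T -> nat,
  injective idx /\ forall x y, e x y -> consecutive (idx x) (idx y).
Proof.
have [ss [uss allss lss]] := path_decomposition.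
exists (fun x => index x (flatten ss)); split.
  by move=> x y; exact: index_inj (allss x) (allss y).

move=> x y; move: (allss x) => {allss}.
elim: ss lss uss => //= s ss IH lss; rewrite cat_uniq mem_cat => /and3P[us dis uss].
have [_ ls] := lss s (mem_head _ _).
have {}IH := IH (fun t ht => lss t (@mem_behead _ (s :: ss) t ht)) uss.
rewrite !index_cat; have [xs _|xs /= xss] := boolP (x \in s).
  by rewrite ls // => /andP[->].
have [ys|ys] := boolP (y \in s).
  by rewrite e_sym ls // (negbTE xs).
by move=> /(IH xss); rewrite /consecutive -!addnS !eqn_add2l.
Qed.

End Decomposition.

Lemma isomorphic_sym (F G : sgraph) : isomorphic F G -> isomorphic G F.
Proof.
move=> [f [[g fK gK] fadj]]; exists g; split; first by exists f.
by move=> x y; rewrite -fadj !gK.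
Qed.

Lemma linear_forest_degree_acyclic (L : sgraph) :
  (forall x : L, #|[set y | adj x y]| <= 2)%N ->
  (forall s : seq L, uniq s -> cycle (@adj L) s -> (size s < 3)%N) ->
  linear_forest L.
Proof.
move=> deg acyc.
have [ss [uss allss lss]] := path_decomposition (@adj_sym L) (@adj_irrefl L) deg acyc.
pose sq (i : 'I_(size ss)) := nth [::] ss i.
exists (size ss), (fun i => size (sq i)); apply: isomorphic_sym.
pose D := dunion (fun i => path_graph (size (sq i))).
pose g (z : D) : L := tnth (in_tuple (sq (tag z))) (tagged z).
have sq_in i : sq i \in ss by exact: mem_nth.
have usq i : uniq (sq i).
  move: (sq_in i) uss; elim: (ss) => //= s ss' IH; rewrite inE cat_uniq.
  by case/predU1P=> [->|/IH h] /and3P[].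
have nth_shape (i : 'I_(size ss)) : nth 0 (shape ss) i = size (sq i) by rewrite (nth_map [::]).
have gE x0 i j : g (existT _ i j) = nth x0 (flatten ss) (flatten_index (shape ss) i j).
  have jlt : (j < nth 0 (shape ss) i)%N by rewrite nth_shape.
  by rewrite nth_flatten flatten_indexKl // flatten_indexKr // /g (tnth_nth x0).
have g_inj : injective g.
  move=> [i j] [i' j']; pose x0 := g (existT _ i j); rewrite !(gE x0) => /eqP.
  have jlt : (j < nth 0 (shape ss) i)%N by rewrite nth_shape.
  have jlt' : (j' < nth 0 (shape ss) i')%N by rewrite nth_shape.
  rewrite nth_uniq ?size_flatten ?flatten_indexP // => /eqP h.
  have ii : i = i' by apply: val_inj; rewrite /= -(flatten_indexKl jlt) h flatten_indexKl.
  subst i'; congr existT; apply: val_inj.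
  by rewrite /= -(flatten_indexKr jlt) h flatten_indexKr.
have g_surj x : exists z, g z == x.
  have /flattenP[s sss xs] := allss x.
  have ilt : (index s ss < size ss)%N by rewrite index_mem.
  have jlt : (index x s < size (sq (Ordinal ilt)))%N by rewrite /sq nth_index // index_mem.
  exists (existT _ (Ordinal ilt) (Ordinal jlt)).
  by rewrite /g (tnth_nth x) /= /sq nth_index // nth_index.
exists g; split.
  exists (fun x => xchoose (g_surj x)); last by move=> x; exact: (eqP (xchooseP (g_surj x))).
  by move=> z; apply: g_inj; exact: (eqP (xchooseP (g_surj (g z)))).
move=> [i j] [i' j']; set x := g _; set y := g _.
have xi : x \in sq i by exact: mem_tnth.
have idx (z : D) : index (g z) (sq (tag z)) = tagged z.
  rewrite /g (tnth_nth x); exact: index_uniq (ltn_ord _) (usq _).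
have [_ ls] := lss _ (sq_in i); rewrite ls // /D /= /dunion_adj /=.
have [ii|ii] := eqVneq i i'; last first.
  apply/negbTE; rewrite negb_and; apply/orP; left; apply: contra ii => yi.
  have jlt : (index y (sq i) < size (sq i))%N by rewrite index_mem.
  have : g (existT _ i (Ordinal jlt)) = g (existT _ i' j').
    by rewrite /g (tnth_nth x) /= nth_index.
  by move=> /g_inj /(congr1 tag) /= ->.
subst i'; have yi : y \in sq i by exact: mem_tnth.
by rewrite yi tagged_asE /= (idx (existT _ i j)) (idx (existT _ i j')).
Qed.

Lemma linear_forest_index (L : sgraph) : linear_forest L ->
  exists idx : L -> nat, injective idx /\ forall x y, adj x y -> consecutive (idx x) (idx y).
Proof.
move=> [k [m [f [/bij_inj f_inj fadj]]]].
pose off (i : 'I_k) := (\sum_(i' < k | i' < i) m i')%N.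
have off_lt (i i' : 'I_k) : (i < i')%N -> (off i + m i <= off i')%N.
  move=> ii'; rewrite /off [leqRHS](bigD1 i) //= addnC leq_add2l.
  rewrite big_mkcond [leqRHS]big_mkcond; apply: leq_sum => l _.
  case: (ltnP l i) => // li; rewrite (ltn_trans li ii') /=.
  by rewrite -val_eqE /= ltn_eqF.
pose idx (z : dunion (fun i => path_graph (m i))) := (off (tag z) + tagged z)%N.
exists (fun x => idx (f x)); split => [x y|x y].
  move=> h; apply: f_inj; case: (f x) (f y) h => [i j] [i' j']; rewrite /idx /= => h.
  have [ij ij'] := (ltn_ord j, ltn_ord j').
  have ii : i = i'.
    by apply: val_inj; case: (ltngtP i i') => // /off_lt; lia.
  subst i'; congr existT; apply: val_inj => /=; lia.
rewrite -fadj; case: (f x) (f y) => [i j] [i' j'] /= /andP[/eqP /= ii].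
subst i'; rewrite tagged_asE /= /idx /path_adj /consecutive /= => h; lia.
Qed.

Lemma consecutive_degree (T : finType) (A : {set T}) (idx : T -> nat) (n : nat) :
  {in A &, injective idx} -> (forall y, y \in A -> consecutive n (idx y)) -> (#|A| <= 2)%N.
Proof.
move=> inj h; rewrite cardE -(size_map idx).
have un : uniq [seq idx y | y <- enum A].
  by rewrite map_inj_in_uniq ?enum_uniq // => x y; rewrite !mem_enum; exact: inj.
apply: (uniq_leq_size (s2 := [:: n.+1; n.-1]) un) => _ /mapP[y + ->].
rewrite mem_enum => /h; rewrite /consecutive !inE; lia.
Qed.

End LinearForests.

Local Open Scope ring_scope.

(** * Quadratic forms of graphs *)

Section QuadraticForms.
Variables (R : realType) (T : finType) (e : rel T).
Implicit Types x y : T -> R.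

(** Vectors are functions on the vertices rather than rows indexed by ordinals, so that relations on
    the same type share their test vectors. *)
Definition quad (x : T -> R) : R := \sum_a \sum_b (e a b)%:R * x a * x b.

Definition sqnorm (x : T -> R) : R := \sum_a x a ^+ 2.

Definition nbr_sum (x : T -> R) a : R := \sum_(b | e a b) x b.

Lemma nbr_sumE x a : nbr_sum x a = \sum_b (e a b)%:R * x b.
Proof.
rewrite /nbr_sum big_mkcond; apply: eq_bigr => b _.
by case: (e a b); rewrite ?mul1r ?mul0r.
Qed.

Lemma quadE x : quad x = \sum_a x a * nbr_sum x a.
Proof.
apply: eq_bigr => a _; rewrite nbr_sumE mulr_sumr; apply: eq_bigr => b _.
by rewrite mulrCA mulrA.
Qed.

Lemma sqnorm_ge0 x : 0 <= sqnorm x.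
Proof. by apply: sumr_ge0 => a _; exact: sqr_ge0. Qed.

Lemma sqnorm_eq0 x : sqnorm x = 0 -> forall a, x a = 0.
Proof.
move=> h a; have /psumr_eq0P : forall a, true -> 0 <= x a ^+ 2 by move=> *; exact: sqr_ge0.
by move=> /(_ h a isT)/eqP; rewrite sqrf_eq0 => /eqP.
Qed.

Lemma quadZ c x : quad (fun a => c * x a) = c ^+ 2 * quad x.
Proof.
rewrite /quad mulr_sumr; apply: eq_bigr => a _; rewrite mulr_sumr.
by apply: eq_bigr => b _; ring.
Qed.

Lemma sqnormZ c x : sqnorm (fun a => c * x a) = c ^+ 2 * sqnorm x.
Proof. by rewrite /sqnorm mulr_sumr; apply: eq_bigr => a _; rewrite exprMn. Qed.

Lemma quad_norm x : quad x <= quad (fun a => `|x a|).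
Proof.
apply: ler_sum => a _; apply: ler_sum => b _.
rewrite -!mulrA; apply: ler_wpM2l; first exact: ler0n.
by rewrite -normrM ler_norm.
Qed.

Lemma sqnorm_norm x : sqnorm (fun a => `|x a|) = sqnorm x.
Proof. by apply: eq_bigr => a _; rewrite real_normK ?num_real. Qed.

Hypotheses (e_sym : symmetric e) (e_irr : irreflexive e).

Lemma quad_perturb x a t :
  quad (fun b => x b + t * (b == a)%:R) = quad x + 2 * t * nbr_sum x a.
Proof.
rewrite [in LHS]quadE.
have nbrE b : nbr_sum (fun b => x b + t * (b == a)%:R) b = nbr_sum x b + t * (e b a)%:R.
  rewrite !nbr_sumE; under eq_bigr do rewrite mulrDr.
  rewrite big_split /=; congr (_ + _).
  rewrite (bigD1 a) //= eqxx big1 ?addr0 ?mulr1 1?mulrC // => c ca.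
  by rewrite (negbTE ca) !mulr0.
under eq_bigr do rewrite nbrE mulrDl.
rewrite big_split /= [X in _ + X](bigD1 a) //= eqxx e_irr mulr0 addr0 mulr1.
rewrite [X in _ + (_ + X)]big1 ?addr0; last by move=> b /negbTE ->; rewrite mulr0 mul0r.
under eq_bigr do rewrite mulrDr.
rewrite big_split /= -quadE -addrA; congr (_ + _).
rewrite [nbr_sum x a in RHS]nbr_sumE.
have -> : \sum_i x i * (t * (e i a)%:R) = t * \sum_i (e a i)%:R * x i.
  by rewrite mulr_sumr; apply: eq_bigr => i _; rewrite e_sym; ring.
by rewrite nbr_sumE; ring.
Qed.

Lemma sqnorm_perturb x a t :
  sqnorm (fun b => x b + t * (b == a)%:R) = sqnorm x + 2 * t * x a + t ^+ 2.
Proof.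
rewrite /sqnorm (bigD1 a) //= [in RHS](bigD1 a) //= eqxx.
rewrite [X in _ + X = _](eq_bigr (fun b => x b ^+ 2)); first by rewrite mulr1; ring.
by move=> b /negbTE ->; rewrite mulr0 addr0.
Qed.

(* First-order optimality in the direction of each basis vector. *)
Lemma extremal_eigenvector (rho : R) x : (forall y, quad y <= rho * sqnorm y) ->
  quad x = rho * sqnorm x -> forall a, nbr_sum x a = rho * x a.
Proof.
move=> ub eq_x a; apply/eqP; rewrite -subr_eq0; apply/eqP; set d := _ - _.
have [//|d0] := eqVneq d 0; exfalso.
(* Moving [x] by [t] along the basis vector of [a] forces [2 * t * d <= rho * t ^+ 2]; with this [t]
   the left side is [2 * t ^+ 2 * (|rho| + 1)], which is too large. *)
pose t := d / (`|rho| + 1).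
have r1 : 0 < `|rho| + 1 by rewrite ltr_pwDr.
have := ub (fun b => x b + t * (b == a)%:R).
rewrite quad_perturb sqnorm_perturb eq_x => h.
have {h} : 2 * t * d <= rho * t ^+ 2 by rewrite /d; nra.
have dE : d = t * (`|rho| + 1) by rewrite /t divfK // gt_eqF.
have t0 : 0 < t ^+ 2.
  by rewrite exprn_even_gt0 //=; apply: contraNneq d0; rewrite dE => ->; rewrite mul0r.
rewrite {}dE; have := ler_norm rho; nra.
Qed.

End QuadraticForms.

(** * Weight of disjoint copies of P_3 *)

Section Triples.
Variable R : realType.

(* Cutting a nonincreasing sequence into triples [a >= b >= c] costs at most a
   third of the weight: [ab + bc >= b^2 + c^2], and [a^2] is at most the mean of
   the last two squares of the previous triple. *)
Lemma triples_weight (y : nat -> R) (m : nat) :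
  (forall i, 0 <= y i) -> (forall i, y i.+1 <= y i) -> (forall i, (m <= i)%N -> y i = 0) ->
  2 * \sum_(i < m) y i ^+ 2 <=
    2 * y 0 ^+ 2 + 3 * \sum_(i < m) ((i %% 3)%N != 2)%:R * (y i * y i.+1).
Proof.
move=> y0 y_anti y_end.
pose w i := ((i %% 3)%N != 2)%:R * (y i * y i.+1) : R.
(* The additional square is the first one of the next triple, paid in advance by the triple before
   it; for the very first triple it is the [2 * y 0 ^+ 2] on the right. *)
have step k : 2 * \sum_(i < 3 * k) y i ^+ 2 + 2 * y (3 * k)%N ^+ 2 <=
    2 * y 0 ^+ 2 + 3 * \sum_(i < 3 * k) w i.
  elim: k => [|k IH]; first by rewrite !big_ord0 !mulr0 add0r addr0.
  rewrite mulnS addnC !addnS addn0 !big_ord_recr /= /w.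
  have [-> [-> ->]] : (3 * k %% 3 = 0 /\ (3 * k).+1 %% 3 = 1 /\ (3 * k).+2 %% 3 = 2)%N by lia.
  rewrite /= !mul1r mul0r addr0.
  move: IH; set S := \sum_(i < _) _; set P := \sum_(i < _) _.
  have := y_anti (3 * k)%N; have := y_anti (3 * k).+1; have := y_anti (3 * k).+2.
  have := y0 (3 * k).+1; have := y0 (3 * k).+2; have := y0 (3 * k).+3.
  move: (y (3 * k)%N) (y (3 * k).+1) (y (3 * k).+2) (y (3 * k).+3) => a b c d.
  move=> d0 c0 b0 dc cb ba IH.
  have h1 : b ^+ 2 <= a * b by rewrite expr2 ler_wpM2r.
  have h2 : c ^+ 2 <= b * c by rewrite expr2 ler_wpM2r.
  have h3 : d ^+ 2 <= c ^+ 2 by rewrite ler_pXn2r.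
  have h4 : c ^+ 2 <= b ^+ 2 by rewrite ler_pXn2r.
  lra.
have ext (F : nat -> R) : (forall i, (m <= i)%N -> F i = 0) ->
    \sum_(i < 3 * m) F i = \sum_(i < m) F i.
  move=> F0; rewrite -!(big_mkord xpredT F) (big_cat_nat (n := m)) //=; last by lia.
  rewrite [X in _ + X](_ : _ = 0) ?addr0 // big_nat_cond big1 // => i.
  by move=> /andP[/andP[mi _] _]; exact: F0.
have := step m; rewrite (ext (fun i => y i ^+ 2)); last by move=> i mi; rewrite y_end // expr0n.
rewrite (ext w); last by move=> i mi; rewrite /w y_end // mul0r mulr0.
by apply: le_trans; rewrite lerDl mulr_ge0 ?sqr_ge0.
Qed.

End Triples.

Section InnerForms.
Variables (R : realType) (V : finType).
Implicit Types (e l : rel V) (x : V -> R) (A B S : {set V}).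

Definition quad_in e A x : R := \sum_(a in A) \sum_(b in A) (e a b)%:R * x a * x b.

(** [W] is sorted by decreasing entries and cut into triples, each of them spanning a path. The
    factor is 3/2 instead of 3 since [quad_in] counts every edge twice. *)
Lemma triple_layout x (W : {set V}) : (forall a, 0 <= x a) ->
  exists (l : rel V) (idx : V -> nat),
  [/\ symmetric l, {in W &, injective idx},
      forall a b, l a b -> [/\ a \in W, b \in W, consecutive (idx a) (idx b) &
        (idx a %/ 3 = idx b %/ 3)%N] &
      forall M, (forall a, a \in W -> x a <= M) ->
        2 * \sum_(a in W) x a ^+ 2 <= 2 * M ^+ 2 + 3 / 2 * quad_in l W x].
Proof.
move=> x0; pose ge : rel V := fun a b => x b <= x a.
have ge_total : total ge by move=> a b; exact: le_total.
have ge_trans : transitive ge by move=> b a c ab bc; exact: le_trans bc ab.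
pose s := sort ge (enum W); pose idx a := index a s.
have us : uniq s by rewrite sort_uniq enum_uniq.
have sW a : (a \in s) = (a \in W) by rewrite mem_sort mem_enum.
pose l : rel V := fun a b => [&& a \in W, b \in W, consecutive (idx a) (idx b) &
  (idx a %/ 3 == idx b %/ 3)%N].
exists l, idx; split.
- by move=> a b; rewrite /l consecutive_sym eq_sym andbCA.
- by move=> a b; rewrite -!sW => a_s b_s; exact: index_inj a_s b_s.
- by move=> a b /and4P[-> -> -> /eqP ->].
move=> M xM; have [->|/set0Pn[w0 w0W]] := eqVneq W set0.
  by rewrite /quad_in !big_set0 !mulr0 addr0 mulr_ge0 ?sqr_ge0.
pose m := size s; pose y i := if (i < m)%N then x (nth w0 s i) else 0.
have sumW (F : V -> R) : \sum_(a in W) F a = \sum_(i < m) F (nth w0 s i).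
  rewrite -big_enum /= (perm_big s) /=; last by rewrite perm_sym perm_sort.
  by rewrite (big_nth w0) big_mkord.
have yE (i : 'I_m) : y i = x (nth w0 s i) by rewrite /y ltn_ord.
have y_ge0 i : 0 <= y i by rewrite /y; case: ifP.
have y_anti i : y i.+1 <= y i.
  rewrite /y; case: ltnP => im; last by case: ifP.
  rewrite (ltn_trans _ im) //.
  by have /(sortedP w0)/(_ i im) := sort_sorted ge_total (enum W).
have y_end i : (m <= i)%N -> y i = 0 by move=> mi; rewrite /y ltnNge mi.
have := triples_weight y_ge0 y_anti y_end.
rewrite (eq_bigr (fun i : 'I_m => x (nth w0 s i) ^+ 2)) => [|i _]; last by rewrite yE.
rewrite -(sumW (fun a => x a ^+ 2)) => h; apply: le_trans h _; apply: lerD.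
  have M0 : 0 <= M := le_trans (x0 w0) (xM _ w0W).
  rewrite ler_pM2l //; apply: lerXn2r; rewrite ?nnegrE //.
  by rewrite /y; case: ifP => // i0; apply: xM; rewrite -sW mem_nth.
suff -> : quad_in l W x = 2 * \sum_(i < m) ((i %% 3)%N != 2)%:R * (y i * y i.+1).
  by rewrite le_eqVlt; apply/orP; left; apply/eqP; field.
pose f i j : R := ((i.+1 == j) && (i %/ 3 == j %/ 3)%N)%:R * y i * y j.
have -> : quad_in l W x = \sum_(i < m) \sum_(j < m) (f i j + f j i).
  rewrite /quad_in sumW; apply: eq_bigr => i _; rewrite sumW; apply: eq_bigr => j _.
  rewrite /f !yE /l -!sW !mem_nth //= /consecutive /idx !index_uniq // [(j %/ 3)%N == _]eq_sym.
  have : ~~ ((i.+1 == j) && (j.+1 == i)) by lia.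
  by case: (i.+1 == j) (j.+1 == i) (_ == _) => [] [] [] //= _; ring.
rewrite (eq_bigr _ (fun i _ => big_split _ _ _ _ _)) big_split /=.
rewrite [X in _ + X]exchange_big /= mulr_natl mulr2n.
suff h : \sum_(i < m) \sum_(j < m) f i j = \sum_(i < m) ((i %% 3)%N != 2)%:R * (y i * y i.+1).
  by rewrite h.
apply: eq_bigr => i _; have [im|im] := ltnP i.+1 m.
  rewrite (bigD1 (Ordinal im)) //= big1 ?addr0 => [|j]; last first.
    by rewrite -val_eqE /= eq_sym /f => /negbTE ->; rewrite !mul0r.
  rewrite /f eqxx /= mulrA; congr (_ * _ * _); congr (_%:R); congr nat_of_bool; lia.
rewrite (y_end i.+1 im) !mulr0 big1 // => j _; rewrite /f.
rewrite (_ : (i.+1 == j) = false) ?mul0r //; have := ltn_ord j; lia.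
Qed.

End InnerForms.

(** * Quadratic forms of sparse graphs *)

Section SparseForms.
Variables (R : realType) (V : finType) (e : rel V) (x : V -> R).
Hypotheses (e_sym : symmetric e) (e_irr : irreflexive e) (x0 : forall a, 0 <= x a).
Implicit Types (A B S : {set V}).

Definition cross A B : R := \sum_(a in A) \sum_(b in B) (e a b)%:R * x a * x b.

Lemma crossC A B : cross A B = cross B A.
Proof.
rewrite /cross exchange_big; apply: eq_bigr => b _; apply: eq_bigr => a _.
by rewrite e_sym; ring.
Qed.

Lemma quad_inID A S : quad_in e S x =
  quad_in e (S :&: A) x + 2 * cross (S :\: A) (S :&: A) + quad_in e (S :\: A) x.
Proof.
have split (F : V -> R) : \sum_(a in S) F a = \sum_(a in S :&: A) F a + \sum_(a in S :\: A) F a.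
  by rewrite (big_setID A).
rewrite {1}/quad_in split (eq_bigr _ (fun a _ => split _)) big_split /=.
rewrite -/(quad_in e (S :&: A) x) -/(cross (S :&: A) (S :\: A)).
rewrite [X in _ + X](eq_bigr _ (fun a _ => split _)) big_split /=.
rewrite -/(quad_in e (S :\: A) x) -/(cross (S :\: A) (S :&: A)) [cross (S :&: A) _]crossC; ring.
Qed.

Lemma cross_nbr A B : cross A B = \sum_(a in A) x a * \sum_(b in nbr_in e B a) x b.
Proof.
apply: eq_bigr => a _; rewrite mulr_sumr [RHS]big_mkcond [LHS]big_mkcond.
apply: eq_bigr => b _; rewrite inE; case: (b \in B) => //=.
by case: (e a b); rewrite ?mul1r ?mul0r.
Qed.

Lemma cross_le A B (M : R) k : (forall b, b \in B -> x b <= M) -> 0 <= M ->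
  (forall a, a \in A -> (#|nbr_in e B a| <= k)%N) ->
  cross A B <= k%:R * M * \sum_(a in A) x a.
Proof.
move=> xM M0 deg; rewrite cross_nbr mulr_sumr; apply: ler_sum => a aA.
rewrite mulrC ler_wpM2r //; apply: le_trans (_ : M * #|nbr_in e B a|%:R <= _).
  rewrite mulr_natr -sumr_const; apply: ler_sum => b; rewrite inE => /andP[bB _]; exact: xM.
by rewrite mulrC ler_wpM2r // ler_nat deg.
Qed.

(** Vertices of low degree are removed one by one; the edges from [s] to what is left contribute at
    most [2 * k * M * x s]. The bound is linear in the entries, so it can be set against the gain
    from joining these vertices to the hubs. *)
Lemma quad_in_degenerate (M : R) k S : (forall b, b \in S -> x b <= M) -> 0 <= M ->
  (forall A, A != set0 -> exists2 a, a \in A & (#|nbr_in e A a| <= k)%N) ->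
  quad_in e S x <= 2 * k%:R * M * \sum_(a in S) x a.
Proof.
move=> + M0 low; have [m] := ubnP #|S|; elim: m S => // m IH S; rewrite ltnS => Sm xM.
have [->|S0] := eqVneq S set0; first by rewrite /quad_in !big_set0 mulr0.
have [s sS ds] := low S S0.
have D1 : S :&: [set s] = [set s] by apply/setIidPr; rewrite sub1set.
have hIH : quad_in e (S :\ s) x <= 2 * k%:R * M * \sum_(a in S :\ s) x a.
  apply: IH; first by move: Sm; rewrite (cardsD1 s S) sS.
  by move=> b /setD1P[_]; exact: xM.
rewrite (quad_inID [set s]) D1.
have -> : quad_in e [set s] x = 0.
  by rewrite /quad_in !big_set1 e_irr !mul0r.
rewrite crossC (big_setD1 s) //=.
have : cross [set s] (S :\ s) <= k%:R * M * \sum_(a in [set s]) x a.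
  apply: cross_le => // [b /setD1P[_]|a /set1P ->]; first exact: xM.
  by apply: leq_trans ds; apply: subset_leq_card; apply/subsetP => z; rewrite !inE =>
    /andP[/andP[_ ->]].
rewrite big_set1; move: hIH; lra.
Qed.

(** From [2 * x a * x b <= x a ^+ 2 + x b ^+ 2], every square being used by at most two edges. *)
Lemma quad_in_degree2 S : (forall a, a \in S -> (#|nbr_in e S a| <= 2)%N) ->
  quad_in e S x <= 2 * \sum_(a in S) x a ^+ 2.
Proof.
move=> deg.
have hsq : \sum_(a in S) \sum_(b in S) (e a b)%:R * x a ^+ 2 <= 2 * \sum_(a in S) x a ^+ 2.
  rewrite mulr_sumr; apply: ler_sum => a aS; rewrite -mulr_suml ler_wpM2r ?sqr_ge0 //.
  rewrite -natr_sum ler_nat; apply: leq_trans (deg a aS).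
  rewrite -sum1_card [leqRHS]big_mkcond [leqLHS]big_mkcond; apply: leq_sum => b _.
  by rewrite inE; case: (b \in S) (e a b) => [] [].
have hsq' : \sum_(a in S) \sum_(b in S) (e a b)%:R * x b ^+ 2 =
    \sum_(a in S) \sum_(b in S) (e a b)%:R * x a ^+ 2.
  by rewrite exchange_big; apply: eq_bigr => a _; apply: eq_bigr => b _; rewrite e_sym.
apply: le_trans hsq; rewrite -(ler_pM2l (ltr0n R 2)) [leRHS]mulr_natl mulr2n -[X in _ <= _ + X]hsq'.
rewrite -big_split mulr_sumr; apply: ler_sum => a _; rewrite -big_split mulr_sumr;
  apply: ler_sum => b _ /=.
case: (e a b); rewrite ?mul0r ?mulr0 ?addr0 // !mul1r.
by have := sqr_ge0 (x a - x b); rewrite sqrrB; lra.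
Qed.

End SparseForms.

(** * Comparison with K_2 + L on the same vertex set *)

Section Hubs.
Variables (R : realType) (V : finType) (u v : V).
Hypothesis uv : u != v.
Definition inner_set : {set V} := ~: [set u; v].
Local Notation W := inner_set.

Definition hub_rel (l : rel V) : rel V := fun a b =>
  (a != b) && [|| a \notin W, b \notin W | l a b].

Lemma hub_sym l : symmetric l -> symmetric (hub_rel l).
Proof. by move=> l_sym a b; rewrite /hub_rel eq_sym l_sym orbCA. Qed.

Lemma hub_irr l : irreflexive (hub_rel l).
Proof. by move=> a; rewrite /hub_rel eqxx. Qed.

Lemma sum_hubs (F : V -> R) : \sum_a F a = F u + F v + \sum_(a in W) F a.
Proof.
rewrite (bigD1 u) //= (bigD1 v) /=; last by rewrite eq_sym.
by rewrite addrA; congr (_ + _); apply: eq_bigl => a; rewrite !inE negb_or.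
Qed.

Lemma quad_hubs (e : rel V) (x : V -> R) : symmetric e -> irreflexive e ->
  quad e x = 2 * (e u v)%:R * x u * x v +
    2 * \sum_(w in W) ((e u w)%:R * x u + (e v w)%:R * x v) * x w + quad_in e W x.
Proof.
move=> e_sym e_irr; rewrite /quad sum_hubs !sum_hubs !e_irr (e_sym v u).
rewrite (eq_bigr _ (fun a _ => sum_hubs _)) !big_split /=.
have -> : \sum_(a in W) ((e u a)%:R * x u + (e v a)%:R * x v) * x a =
    \sum_(a in W) (e u a)%:R * x u * x a + \sum_(a in W) (e v a)%:R * x v * x a.
  by rewrite -big_split; apply: eq_bigr => a _; rewrite mulrDl.
have h h' : \sum_(i in W) (e i h')%:R * x i * x h' = \sum_(i in W) (e h' i)%:R * x h' * x i.
  by apply: eq_bigr => a _; rewrite e_sym; ring.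
rewrite !h // -/(quad_in e W x); ring.
Qed.

Lemma hub_relW l a b : irreflexive l -> a \in W -> b \in W -> hub_rel l a b = l a b.
Proof.
by move=> l_irr aW bW; rewrite /hub_rel aW bW /=; case: eqVneq => // ->; rewrite l_irr.
Qed.

Lemma quad_hub_rel (l : rel V) (x : V -> R) : symmetric l -> irreflexive l ->
  quad (hub_rel l) x = 2 * x u * x v + 2 * (x u + x v) * \sum_(w in W) x w + quad_in l W x.
Proof.
move=> l_sym l_irr; rewrite quad_hubs //; [|exact: hub_sym|exact: hub_irr].
have hubs h w : h \in [set u; v] -> w \in W -> hub_rel l h w.
  move=> hh wW; rewrite /hub_rel [h \in W]inE hh /= andbT.
  by apply: contraTneq wW => <-; rewrite inE hh.
congr (_ + _ + _).
- by rewrite /hub_rel uv !inE eqxx mulr1.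
- rewrite -[RHS]mulrA; congr (_ * _); rewrite mulr_sumr; apply: eq_bigr => w wW.
  by rewrite !hubs ?set21 ?set22 ?mul1r.
- by apply: eq_bigr => a aW; apply: eq_bigr => b bW; rewrite hub_relW.
Qed.

Section Comparison.
Variables (e : rel V) (x : V -> R).
Hypotheses (e_sym : symmetric e) (e_irr : irreflexive e) (x0 : forall a, 0 <= x a).
Let C := [set w | e u w && e v w].
Hypothesis C_deg : forall w, w \in W -> (#|nbr_in e C w| <= 2)%N.
Hypothesis low : forall A : {set V}, A != set0 -> exists2 a, a \in A & (#|nbr_in e A a| <= 32)%N.
Hypotheses (xu1 : x u = 1) (xv1 : x v <= 1) (xv9 : 9 / 10 <= x v).
Hypothesis x_small : forall w, w \in W -> x w <= 1 / 100.

Let SB := \sum_(w in W :\: C) x w.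

(** Edges between exceptional and common vertices cost [2 * 2 / 100], edges among exceptional ones
    [2 * 32 / 100], per unit of [SB]. *)
Lemma quad_in_split_bound :
  quad_in e W x <= quad_in e (W :&: C) x + 68 / 100 * SB.
Proof.
rewrite (quad_inID x e_sym C).
have h1 : cross e x (W :\: C) (W :&: C) <= 2%:R * (1 / 100) * SB.
  apply: cross_le => // [b /setIP[bW _]||a /setDP[aW _]]; [exact: x_small|lra|].
  apply: leq_trans (C_deg aW); apply: subset_leq_card; apply/subsetP => z.
  by rewrite [z \in nbr_in _ _ _]inE => /andP[/setIP[_ zC] az]; rewrite inE zC.
have h2 : quad_in e (W :\: C) x <= 2 * 32%:R * (1 / 100) * SB.
  by apply: quad_in_degenerate => // [b /setDP[bW _]|]; [exact: x_small|lra].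
move: h1 h2; lra.
Qed.

(** An exceptional vertex misses at least one hub, and both hubs have entries of at least 9/10. *)
Lemma hub_sum_bound :
  \sum_(w in W) ((e u w)%:R * x u + (e v w)%:R * x v) * x w + 9 / 10 * SB
    <= (x u + x v) * \sum_(w in W) x w.
Proof.
rewrite /SB !mulr_sumr (big_setID C) [leRHS](big_setID C) /= -addrA; apply: lerD.
  by apply: ler_sum => w /setIP[_]; rewrite inE => /andP[-> ->]; rewrite !mul1r.
rewrite -big_split; apply: ler_sum => w /setDP[_]; rewrite inE negb_and /= => h.
rewrite -mulrDl ler_wpM2r // xu1.
by case: (e u w) (e v w) h => [] [] //= _; move: xv9; lra.
Qed.

(** The gain [2 * 9 / 10] exceeds the loss [68 / 100] by more than 1, per unit of [SB]. *)
Lemma compare_common (l : rel V) : symmetric l -> irreflexive l -> e u v ->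
  quad_in l W x = quad_in e (W :&: C) x ->
  quad e x + SB <= quad (hub_rel l) x.
Proof.
move=> l_sym l_irr euv lE; rewrite quad_hub_rel // quad_hubs // euv lE.
have SB0 : 0 <= SB by apply: sumr_ge0.
move: quad_in_split_bound hub_sum_bound SB0; rewrite mulr1.
set a := quad_in _ _ _; set b := quad_in _ _ _; set c := \sum_(w in W) _.
set d := \sum_(w in W) _; move: (x u + x v) => s; rewrite -!mulrA; lra.
Qed.

(** Let X be the sum of the inner squares. The new edge [uv] gains [2 * x v], at least 18/10. The
    inner form falls from at most 2X plus [68 / 100 * SB] to about 4/3 X. Since X is at most
    slightly above 2, up to a small multiple of [SB], the loss of 2/3 X stays below the gain, and
    the terms in [SB] are covered by [hub_sum_bound]. *)
Lemma compare_triples (l : rel V) (lam : R) : symmetric l -> irreflexive l ->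
  100 <= lam -> (forall a, nbr_sum e x a = lam * x a) -> ~~ e u v ->
  2 * \sum_(a in W) x a ^+ 2 <= 2 * (1 / 100) ^+ 2 + 3 / 2 * quad_in l W x ->
  quad e x < quad (hub_rel l) x.
Proof.
move=> l_sym l_irr lam100 eig nuv hl.
rewrite quad_hub_rel // [quad e x]quad_hubs // (negbTE nuv).
have hub h : h \in [set u; v] -> \sum_(w in W) (e h w)%:R * x w = lam * x h.
  move=> hh; rewrite -eig nbr_sumE sum_hubs.
  have -> : e h u = false by move: hh; rewrite !inE => /orP[]/eqP->;
    rewrite ?e_irr // e_sym (negbTE nuv).
  have -> : e h v = false by move: hh; rewrite !inE => /orP[]/eqP->; rewrite ?e_irr // (negbTE nuv).
  by rewrite !mul0r !add0r.
have crossE : \sum_(w in W) ((e u w)%:R * x u + (e v w)%:R * x v) * x w =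
    lam * (x u ^+ 2 + x v ^+ 2).
  transitivity (x u * \sum_(w in W) (e u w)%:R * x w + x v * \sum_(w in W) (e v w)%:R * x w).
    by rewrite !mulr_sumr -big_split; apply: eq_bigr => w _ /=; ring.
  by rewrite !hub ?set21 ?set22 //; ring.
have normE : quad e x = lam * sqnorm x.
  by rewrite quadE /sqnorm mulr_sumr; apply: eq_bigr => a _; rewrite eig; ring.
have := quad_hubs x e_sym e_irr; rewrite normE /sqnorm sum_hubs (negbTE nuv) crossE.
have SB0 : 0 <= SB by apply: sumr_ge0.
move: hub_sum_bound quad_in_split_bound; rewrite crossE.
have : quad_in e (W :&: C) x <= 2 * \sum_(a in W) x a ^+ 2.
  apply: le_trans (quad_in_degree2 _ _ _) _ => //.
    move=> a /setIP[aW _]; apply: leq_trans (C_deg aW); apply: subset_leq_card.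
    by apply/subsetP => z; rewrite [z \in nbr_in _ _ _]inE => /andP[/setIP[_ zC] az];
      rewrite inE zC.
  rewrite ler_pM2l // [leRHS](big_setID C) /= lerDl; apply: sumr_ge0 => *; exact: sqr_ge0.
have X0 : 0 <= \sum_(a in W) x a ^+ 2 by apply: sumr_ge0 => *; exact: sqr_ge0.
move: hl; rewrite xu1 expr1n !mul1r !mulr1 mulr0 !mul0r add0r.
move: X0 SB0; move: (\sum_(a in W) x a ^+ 2) (quad_in e _ x) (quad_in e W x) (quad_in l W x).
move: (\sum_(w in W) x w) SB => S1 B X qC qW ql X0 B0 hl h1 h2 h3 h4.
have y2 : x v ^+ 2 <= 1 by rewrite expr_le1 // x0.
have Xlam : 100 * X <= lam * X by rewrite ler_wpM2r.
(* The eigenvector equation makes the inner squares balance the two hub squares up to [qW / lam];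
   this is why X is close to 2 at most. *)
have hX : lam * (X - 1 - x v ^+ 2) = qW by move: h4; lra.
have XB : 98 / 100 * X <= 2 + 68 / 10000 * B.
  have : lam * (X - 2) <= 2 * X + 68 / 100 * B by nra.
  nra.
move: xv9; lra.
Qed.

End Comparison.
End Hubs.

(** * Two vertices of almost full degree *)

Section TwoHubs.
Variables (R : realType) (V : finType) (e : rel V).
Hypotheses (e_sym : symmetric e) (e_irr : irreflexive e).
Hypothesis sparse : forall S : {set V}, (degree_sum e S <= 32 * #|S|)%N.
Hypothesis K33_free : forall x y z : V, x != y -> y != z -> z != x ->
  (#|[set w | [&& e x w, e y w & e z w]]| <= 2)%N.
Variables (x : V -> R) (lam eta : R) (u : V).
Hypotheses (x_ge0 : forall a, 0 <= x a) (x_le1 : forall a, x a <= 1) (xu1 : x u = 1).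
Hypothesis eig : forall a, nbr_sum e x a = lam * x a.
Hypotheses (lam0 : 0 < lam) (eta0 : 0 < eta).
Variable n : R.
Hypothesis nE : n = #|V|%:R.
Hypothesis lam2 : 2 * (n - 2) <= lam ^+ 2.
(** The three lower bounds on [n] serve in turn to bound the number of large entries, to absorb the
    bounded exceptional set [T], and to absorb additive constants. *)
Hypothesis n_large1 : (1024 / eta ^+ 2) ^+ 2 <= n.
Hypothesis n_large2 : 2 * (32 / eta) ^+ 4 <= eta * n.
Hypothesis n_large3 : 4 <= eta * n.
Hypothesis eta_small : eta <= 10%:R ^- 7.

Let N v := [set w | e v w].

Let n0 : 0 < n. Proof. by rewrite -(pmulr_rgt0 _ eta0); move: n_large3; lra. Qed.

Let lam2n : n <= lam ^+ 2.
Proof.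
have e7 : 10%:R ^- 7 <= 1 :> R by rewrite invf_le1 ?exprn_gt0 // exprn_ege1 // ler1n.
have : eta * n <= n by apply: ler_piMl; [exact: ltW|exact: le_trans e7].
move: n_large3 lam2; lra.
Qed.

Lemma degree_total : \sum_v (#|N v|%:R : R) <= 32 * n.
Proof.
rewrite -natr_sum nE -natrM ler_nat; have := sparse [set: V]; rewrite cardsT; apply: leq_trans.
rewrite /degree_sum [leqRHS](eq_bigl predT); last by move=> v; rewrite inE.
by apply: leq_sum => v _; apply: subset_leq_card;
  apply/subsetP => w; rewrite !inE.
Qed.

Lemma two_step v : lam ^+ 2 * x v = \sum_(w in N v) \sum_(z in N w) x z.
Proof.
rewrite expr2 -mulrA -eig /nbr_sum mulr_sumr (eq_bigl (fun w => w \in N v)); last by move=> w;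
  rewrite inE.
apply: eq_bigr => w _; rewrite -eig /nbr_sum; apply: eq_bigl => z; by rewrite inE.
Qed.

Lemma sum_le_card (A : {set V}) (c : R) (y : V -> R) :
  (forall a, a \in A -> y a <= c) -> \sum_(a in A) y a <= c * #|A|%:R.
Proof.
move=> h; rewrite mulr_natr -sumr_const; exact: ler_sum.
Qed.

(** Walks of length two that end outside [K] are at most as many as the total degree, each weighing
    at most [c]. It is applied with [K] the large entries first, then with [K] the large degrees. *)
Lemma two_step_split (K : {set V}) c v : 0 <= c -> (forall z, z \notin K -> x z <= c) ->
  lam ^+ 2 * x v <= 32 * c * n + \sum_(w in N v) \sum_(z in nbr_in e K w) x z.
Proof.
move=> c0 hK; rewrite two_step.
have h w : \sum_(z in N w) x z <= c * #|N w|%:R + \sum_(z in nbr_in e K w) x z.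
  rewrite (bigID (mem K)) /= addrC; apply: lerD.
    apply: le_trans (_ : \sum_(z in N w | z \notin K) c <= _).
      by apply: ler_sum => z /andP[_]; exact: hK.
    rewrite mulr_natr -sumr_const; rewrite [leRHS](bigID (mem K)) /= lerDr.
    by apply: sumr_ge0.
  by rewrite le_eqVlt; apply/orP; left; apply/eqP; apply: eq_bigl => z; rewrite !inE andbC.
apply: le_trans (ler_sum _ (fun w _ => h w)) _; rewrite big_split /= lerD2r.
rewrite -mulr_sumr mulrAC mulrC ler_wpM2r //.
apply: le_trans degree_total; rewrite [leRHS](bigID (mem (N v))) /= lerDl.
by apply: sumr_ge0.
Qed.

Let L := [set v | eta <= x v].
Let J := [set v | eta * n <= #|N v|%:R].

(** Each vertex of [L] has degree at least [lam * eta], so [L] has at most [32 * n / (lam * eta)]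
    elements; the constant 1024 is 32 * 32. *)
Lemma card_heavy : 32 * #|L|%:R <= eta * n.
Proof.
have lamE : 1024 / eta ^+ 2 <= lam.
  rewrite -(@ler_pXn2r _ 2) ?nnegrE ?divr_ge0 ?exprn_ge0 ?(ltW lam0) ?(ltW eta0) //.
  exact: le_trans n_large1 lam2n.
have h : lam * eta * #|L|%:R <= 32 * n.
  apply: le_trans degree_total; rewrite -mulrA mulr_natr -sumr_const mulr_sumr.
  rewrite [leRHS](bigID (mem L)) /=; apply: ler_wpDr; first exact: sumr_ge0.
  apply: ler_sum => v; rewrite inE => xv.
  apply: le_trans (_ : lam * x v <= _); first by rewrite ler_pM2l.
  rewrite -eig /nbr_sum (eq_bigl (fun w => w \in N v)); last by move=> w; rewrite inE.
  by rewrite -[leRHS]mul1r; apply: sum_le_card.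
have {}lamE : 1024 <= lam * eta ^+ 2 by rewrite -ler_pdivrMr ?exprn_gt0.
have L0 : 0 <= #|L|%:R :> R by [].
have e2 : 1024 * #|L|%:R <= eta * (lam * eta * #|L|%:R).
  by rewrite (_ : eta * _ = lam * eta ^+ 2 * #|L|%:R); [rewrite ler_wpM2r|ring].
have : eta * (lam * eta * #|L|%:R) <= eta * (32 * n) by rewrite ler_pM2l.
lra.
Qed.

Lemma card_J : #|J|%:R <= 32 / eta.
Proof.
rewrite ler_pdivlMr // -(ler_pM2r n0) -mulrA.
apply: le_trans degree_total; rewrite mulrC mulr_natr -sumr_const.
rewrite [leRHS](bigID (mem J)) /=; apply: ler_wpDr; first exact: sumr_ge0.
by apply: ler_sum => v; rewrite inE.
Qed.

(** 65 is 32 + 32 + 1: walks ending outside [L], then edges from the neighbourhood of [v] to [L],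
    bounded by sparseness through the degree of [v] and the size of [L]. *)
Lemma small_outside_J v : v \notin J -> x v <= 65 * eta.
Proof.
rewrite inE -ltNge => dv.
have outL z : z \notin L -> x z <= eta by rewrite inE -ltNge => /ltW.
have h := two_step_split v (ltW eta0) outL.
have hL : \sum_(w in N v) \sum_(z in nbr_in e L w) x z <= 32 * (#|N v|%:R + #|L|%:R).
  apply: le_trans (_ : \sum_(w in N v) #|nbr_in e L w|%:R <= _).
    by apply: ler_sum => w _; rewrite -[leRHS]mul1r; apply: sum_le_card.
  rewrite -natr_sum -natrD -natrM ler_nat.
  apply: leq_trans (_ : degree_sum e (N v :|: L) <= _)%N.
    rewrite /degree_sum [leqRHS](bigID (mem (N v))) /=.
    rewrite [X in (_ <= X + _)%N](eq_bigl (fun w => w \in N v)); last first.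
      by move=> w; rewrite inE; case: (w \in N v); rewrite ?andbF.
    apply: leq_trans (leq_addr _ _); apply: leq_sum => w _; apply: subset_leq_card.
    by apply/subsetP => z; rewrite !inE => /andP[-> ->]; rewrite orbT.
  apply: leq_trans (sparse _) _; rewrite leq_mul2l /= cardsU; exact: leq_subr.
have hl := card_heavy.
have xl : n * x v <= lam ^+ 2 * x v by rewrite ler_wpM2r.
rewrite -(ler_pM2l n0) mulrCA mulrA; move: h hL hl xl dv.
rewrite [eta * n]mulrC; lra.
Qed.

Let T := [set w | (2 < #|nbr_in e J w|)%N].

(** Double counting: each vertex of [T] sees three distinct vertices of [J], and such a triple has
    at most two common neighbours. *)
Lemma card_T : (#|T| <= 2 * #|J| ^ 3)%N.
Proof.
pose D := [set t : V * V * V | [&& t.1.1 \in J, t.1.2 \in J & t.2 \in J]].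
pose adjt (t : V * V * V) w := [&& t.1.1 != t.1.2, t.1.2 != t.2, t.2 != t.1.1,
  e t.1.1 w, e t.1.2 w & e t.2 w].
have cD : #|D| = (#|J| ^ 3)%N.
  have -> : D = setX (setX J J) J by apply/setP => -[[a b] c]; rewrite !inE /= andbA.
  by rewrite !cardsX !expnS muln1 mulnA.
rewrite -cD mulnC -sum_nat_const -sum1_card.
apply: leq_trans (_ : \sum_(w in T) \sum_(t in D) adjt t w <= _)%N.
  apply: leq_sum => w; rewrite inE => /card_gt2P[a [b [c [[aJ bJ cJ] [ab bc ca]]]]].
  move: aJ bJ cJ; rewrite !inE => /andP[aJ ea] /andP[bJ eb] /andP[cJ ec].
  rewrite (bigD1 ((a, b), c)) /=; last by rewrite !inE /= aJ bJ cJ.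
  by rewrite /adjt /= ab bc ca !(e_sym _ w) ea eb ec.
rewrite exchange_big /=; apply: leq_sum => -[[a b] c] _.
have [/and3P[ab bc ca]|h] := boolP [&& a != b, b != c & c != a].
  apply: leq_trans (K33_free ab bc ca).
  rewrite -sum1_card big_mkcond [leqRHS]big_mkcond; apply: leq_sum => w _.
  by rewrite inE /adjt /= ab bc ca /=; case: (w \in T); case: ifP.
rewrite big1 // => w _; rewrite /adjt /=.
by move: h; case: (a != b); case: (b != c); case: (c != a).
Qed.

(* Outside the bounded set [T] every vertex has at most two neighbours in [J]. *)
Lemma two_step_J v c : 0 <= c -> (forall w, w \in N v -> w \notin T ->
    \sum_(z in nbr_in e J w) x z <= c) ->
  lam ^+ 2 * x v <= 2081 * (eta * n) + c * #|N v|%:R.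
Proof.
move=> c0 hc; have e65 : 0 <= 65 * eta by rewrite mulr_ge0 // ltW.
apply: le_trans (two_step_split v e65 small_outside_J) _.
have inJ w : \sum_(z in nbr_in e J w) x z <= #|J|%:R.
  apply: le_trans (_ : #|nbr_in e J w|%:R <= _).
    by rewrite -[leRHS]mul1r; apply: sum_le_card.
  rewrite ler_nat; apply: subset_leq_card; apply/subsetP => z; by rewrite inE => /andP[].
have J0 : 0 <= #|J|%:R :> R by [].
(* [T] contributes at most [2 * #|J| ^ 4], absorbed in one [eta * n]; with 32 * 65 = 2080 from the
   small entries this gives 2081. *)
have hT : \sum_(w in N v | w \in T) \sum_(z in nbr_in e J w) x z <= eta * n.
  apply: le_trans (_ : #|J|%:R * #|T|%:R <= _).
    apply: le_trans (_ : \sum_(w in T) #|J|%:R <= _); last by rewrite sumr_const mulr_natr.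
    rewrite [leRHS](bigID (mem (N v))) /=; apply: ler_wpDr; first exact: sumr_ge0.
    rewrite (eq_bigl (fun w => (w \in T) && (w \in N v))); last by move=> w; rewrite andbC.
    exact: ler_sum.
  apply: le_trans n_large2; apply: le_trans (_ : 2 * #|J|%:R ^+ 4 <= _).
    have : #|T|%:R <= 2 * #|J|%:R ^+ 3 :> R by rewrite -natrX -natrM ler_nat card_T.
    by move=> /(ler_wpM2l J0) h; apply: le_trans h _; rewrite le_eqVlt; apply/orP; left;
      apply/eqP; ring.
  by rewrite ler_pM2l // ler_pXn2r ?nnegrE ?divr_ge0 ?(ltW eta0) ?card_J //.
have hN : \sum_(w in N v | w \notin T) \sum_(z in nbr_in e J w) x z <= c * #|N v|%:R.
  apply: le_trans (_ : \sum_(w in N v | w \notin T) c <= _).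
    by apply: ler_sum => w /andP[]; exact: hc.
  rewrite mulr_natr -sumr_const [leRHS](bigID (mem T)) /= lerDr.
  exact: sumr_ge0.
rewrite (bigID (mem T)) /=; move: hT hN; lra.
Qed.

(** Half of the two-step estimate with at most two neighbours in [J], each of entry at most 1; the 4
    in [2 * (n - 2)] costs at most another half of [eta * n]. *)
Lemma degree_weight v : n * x v <= 1041 * (eta * n) + #|N v|%:R.
Proof.
have h : lam ^+ 2 * x v <= 2081 * (eta * n) + 2 * #|N v|%:R.
  apply: two_step_J => // w _; rewrite inE -leqNgt => h2.
  apply: le_trans (_ : #|nbr_in e J w|%:R <= _); last by rewrite ler_nat.
  by rewrite -[leRHS]mul1r; apply: sum_le_card.
have : 2 * (n - 2) * x v <= lam ^+ 2 * x v by rewrite ler_wpM2r.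
have := x_le1 v; have := x_ge0 v; move: h n_large3; nra.
Qed.

Let small : 10%:R ^+ 7 * eta <= 1.
Proof. by rewrite -ler_pdivlMl ?exprn_gt0 // mulr1. Qed.

Let en_small : 10%:R ^+ 7 * (eta * n) <= n.
Proof. by rewrite mulrA ler_piMl // ltW. Qed.

(** With [u] alone in [J], two-step walks from [u] would bound [lam ^+ 2] by about [n] instead of
    [2 * n]. Otherwise let [v] have the largest entry in [J] apart from [u]: outside [T] a neighbour
    of [u] contributes at most [1 + x v], which forces [x v >= 1 - 2082 * eta]. Finally 3123 = 2082
    + 1041. *)
Lemma second_hub : exists v, [/\ v != u, 9 / 10 <= x v & n * (1 - 3123 * eta) <= #|N v|%:R].
Proof.
have du := degree_weight u; rewrite xu1 mulr1 in du.
have uJ : u \in J by rewrite inE; move: du en_small n0; lra.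
have Nn : #|N u|%:R <= n by rewrite nE ler_nat max_card.
have [J0|[v0 v0J]] := set_0Vmem (J :\ u).
  have : lam ^+ 2 * x u <= 2081 * (eta * n) + 1 * #|N u|%:R.
    apply: two_step_J => // w wu _; apply: le_trans (_ : 1 * #|[set u]|%:R <= _);
      last by rewrite cards1 mulr1.
    apply: le_trans (_ : \sum_(z in nbr_in e J w) 1 <= _); first exact: ler_sum.
    rewrite sumr_const mul1r ler_nat; apply: subset_leq_card; apply/subsetP => z.
    rewrite !inE => /andP[zJ _]; apply/negPn/negP => zu.
    by move/setP/(_ z): J0; rewrite !inE zu zJ.
  rewrite xu1 mulr1; move: lam2 Nn en_small n_large3 n0; lra.
pose v := [arg max_(z > v0 | z \in J :\ u) x z]%O.
have [vJ vmax] : v \in J :\ u /\ forall z, z \in J :\ u -> x z <= x v.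
  by rewrite /v; case: arg_maxP.
have {vJ}[vu vJ] := setD1P vJ.
have xv : 1 - 2082 * eta <= x v.
  have : lam ^+ 2 * x u <= 2081 * (eta * n) + (1 + x v) * #|N u|%:R.
    apply: two_step_J; first by rewrite addr_ge0.
    move=> w; rewrite inE => uw; rewrite inE -leqNgt => h2.
    have uN : u \in nbr_in e J w by rewrite inE uJ e_sym.
    rewrite (bigD1 u) //= xu1 lerD2l.
    have h1 : (#|nbr_in e J w :\ u| <= 1)%N by move: h2; rewrite (cardsD1 u) uN.
    rewrite (eq_bigl (fun z => z \in nbr_in e J w :\ u)); last by move=> z; rewrite !inE andbC.
    apply: le_trans (_ : x v * #|nbr_in e J w :\ u|%:R <= _).
      by apply: sum_le_card => z /setD1P[zu]; rewrite inE => /andP[zJ _]; apply: vmax;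
        rewrite !inE zu; move: zJ; rewrite inE.
    by rewrite ler_piMr // -[1]/(1%:R) ler_nat.
  rewrite xu1 mulr1 => h.
  have h' : (1 + x v) * #|N u|%:R <= (1 + x v) * n by rewrite ler_wpM2l // addr_ge0.
  have : n * (1 - 2082 * eta) <= n * x v by move: h h' lam2 n_large3; lra.
  by rewrite ler_pM2l.
exists v; split=> //; first by move: xv small; lra.
have := degree_weight v; have : n * (1 - 2082 * eta) <= n * x v by rewrite ler_pM2l.
lra.
Qed.

(** The hubs miss at most 1041 and 3123 times [eta * n] vertices, together 4164. The bound 4165 on
    the degree of [w] leaves room for two neighbours among the common ones, and (1041 + 4165) *
    [eta] is far below 1/100. *)
Lemma two_hubs : exists v, [/\ v != u, 9 / 10 <= x v,
  #|~: (N u :&: N v)|%:R <= 4164 * (eta * n) &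
  forall w : V, w != u -> w != v -> #|N w|%:R <= 4165 * (eta * n) -> x w <= 1 / 100].
Proof.
have [v [vu xv dv]] := second_hub; exists v; split => //.
  have du := degree_weight u; rewrite xu1 mulr1 in du.
  have hu : (#|~: N u|%:R : R) = n - #|N u|%:R.
    by apply/eqP; rewrite eq_sym subr_eq -natrD nE [(#|~: _| + _)%N]addnC cardsC.
  have hv : (#|~: N v|%:R : R) = n - #|N v|%:R.
    by apply/eqP; rewrite eq_sym subr_eq -natrD nE [(#|~: _| + _)%N]addnC cardsC.
  apply: le_trans (_ : #|~: N u|%:R + #|~: N v|%:R <= _).
    by rewrite setCI -natrD ler_nat; exact: leq_card_setU.
  by rewrite hu hv; lra.
move=> w wu wv dw; rewrite -(ler_pM2l n0).
by move: (degree_weight w) en_small dw n0; lra.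
Qed.

End TwoHubs.

(** * Parity of crossings in the plane *)

Section ChainParity.
Variable R : realType.
Implicit Types (P Q D : R * R) (s t : seq (R * R)).

Definition upper D := (0 < D.2) || ((D.2 == 0) && (0 < D.1)).

(* Parity of crossings of the half-line [x > 0, y = 0] by a short move of a
   vector from [D] to [D']; on the line itself [upper] looks at the sign of [x],
   so that [upper (- D) = ~~ upper D] for every nonzero [D]. *)
Definition crossing D D' := (0 < D.1) && (upper D (+) upper D').

Fixpoint chain_crossing P s Q : bool :=
  if s is P' :: s' then crossing (P - Q) (P' - Q) (+) chain_crossing P' s' Q
  else false.

Fixpoint point_crossing Q P s : bool :=
  if s is P' :: s' then crossing (Q - P) (Q - P') (+) point_crossing Q P' s'
  else false.

Definition within_step (e : R) P P' := (`|P'.1 - P.1| < e) && (`|P'.2 - P.2| < e).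

(** The factor 2 lets both points move by one step at once while the large coordinate of their
    difference keeps its sign. *)
Definition far (e : R) P Q := (2 * e <= `|P.1 - Q.1|) || (2 * e <= `|P.2 - Q.2|).

Lemma upper_large (e : R) D D' : 0 < e -> 2 * e <= `|D.2| ->
  `|D'.2 - D.2| < 2 * e -> upper D' = upper D.
Proof.
rewrite /upper ltr_norml => e0 h0 /andP[]; move: h0.
case: (ltrgt0P D.2) => p h h1 h2; last by exfalso; lra.
- by have -> : 0 < D'.2 by lra.
- have p' : D'.2 < 0 by lra.
  by rewrite (lt_gtF p') (lt_eqF p').
Qed.

Lemma pos_large (e : R) (x x' : R) : 0 < e -> 2 * e <= `|x| ->
  `|x' - x| < 2 * e -> (0 < x') = (0 < x).
Proof.
rewrite ltr_norml => e0 h0 /andP[]; move: h0.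
case: (ltrgt0P x) => p h h1 h2; last by exfalso; lra.
- by apply/idP; lra.
- by apply/negbTE; rewrite -leNgt; lra.
Qed.

(** One coordinate of the difference keeps its sign at all four corners. If it is the first,
    [crossing] is identically false or telescopes as a difference of [upper]; if it is the second,
    [upper] is constant and nothing crosses. *)
Lemma cell (e : R) P P' Q Q' : 0 < e -> far e P Q -> within_step e P P' -> within_step e Q Q' ->
  crossing (P - Q) (P - Q') (+) crossing (P' - Q) (P' - Q')
    = crossing (P - Q) (P' - Q) (+) crossing (P - Q') (P' - Q').
Proof.
move=> e0 + /andP[p1 p2] /andP[q1 q2].
have ex (a b c d : R) : `|b - a| < e -> `|d - c| < e ->
    [/\ `|(b - c) - (a - c)| < 2 * e, `|(a - d) - (a - c)| < 2 * e &
        `|(b - d) - (a - c)| < 2 * e].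
  by rewrite !ltr_norml => /andP[? ?] /andP[? ?]; split; apply/andP; split; lra.
rewrite /crossing /far.
have [x1 x2 x3] := ex _ _ _ _ p1 q1; have [y1 y2 y3] := ex _ _ _ _ p2 q2.
move=> /orP[] h.
  rewrite !(pos_large e0 h x1) !(pos_large e0 h x2).
  case: (0 < _) => //=.
  by case: (upper _) (upper _) (upper _) (upper _) => [] [] [] [].
rewrite (upper_large (D := P - Q) (D' := P' - Q) e0 h y1).
rewrite (upper_large (D := P - Q) (D' := P - Q') e0 h y2).
rewrite (upper_large (D := P - Q) (D' := P' - Q') e0 h y3).
by rewrite addbb !andbF.
Qed.

(** Reversal exchanges the two halves of the horizontal axis, and every change of [upper] crosses
    exactly one of them. *)
Lemma crossing_opp (e : R) D D' : 0 < e ->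
  (2 * e <= `|D.1|) || (2 * e <= `|D.2|) ->
  (2 * e <= `|D'.1|) || (2 * e <= `|D'.2|) ->
  within_step e D D' ->
  crossing (- D) (- D') = crossing D D' (+) (upper D (+) upper D').
Proof.
move=> e0 far0 far0' /andP[c1 c2].
have upN A : (2 * e <= `|A.1|) || (2 * e <= `|A.2|) -> upper (- A) = ~~ upper A.
  rewrite /upper /= !oppr_gt0 oppr_eq0.
  case: (ltrgt0P A.2) => //= _; rewrite (lt_geF (_ : 0 < 2 * e)) ?orbF; last lra.
  by case: (ltrgt0P A.1) => // _; rewrite (lt_geF (_ : 0 < 2 * e)) //; lra.
rewrite /crossing !upN //= oppr_gt0.
case: (ltrgt0P D.1) far0 => [p|p|p]; rewrite /=.
- by move=> _; case: (upper D) (upper D') => [] [].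
- by move=> _; case: (upper D) (upper D') => [] [].
rewrite (lt_geF (_ : 0 < 2 * e)); last lra.
move=> /= h; rewrite (upper_large e0 h) ?addbb //.
by apply: lt_trans c2 _; lra.
Qed.

Definition steps (e : R) P s := path (within_step e) P s.

(** The cells are summed over the grid of pairs of chain points, strip by strip; interior sides
    cancel. *)
Lemma rectangle (e : R) P s Q t : 0 < e ->
  (forall A B, A \in P :: s -> B \in Q :: t -> far e A B) ->
  steps e P s -> steps e Q t ->
  point_crossing P Q t (+) point_crossing (last P s) Q t
   = chain_crossing P s Q (+) chain_crossing P s (last Q t).
Proof.
move=> e0; elim: s P => [|P' s IHs] P H hs ht /=; first by rewrite addbb.
move: hs => /= /andP[cP hs].
have {IHs}IH := IHs P' (fun A B hA hB => H A B (@mem_behead _ (P :: P' :: s) A hA) hB) hs ht.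
have strip : point_crossing P Q t (+) point_crossing P' Q t =
    crossing (P - Q) (P' - Q) (+) crossing (P - last Q t) (P' - last Q t).
  have {}H B : B \in Q :: t -> far e P B by apply: H; rewrite mem_head.
  elim: t Q H ht {IH hs} => [|Q' t IHt] Q H /=; first by rewrite addbb.
  move=> /andP[cQ ht].
  have := IHt Q' (fun B hB => H B (@mem_behead _ (Q :: Q' :: t) B hB)) ht.
  have := cell e0 (H Q (mem_head _ _)) cP cQ.
  move: (crossing _ _) (crossing _ _) (crossing _ _) (crossing _ _) (crossing _ _).
  move: (point_crossing _ _ _) (point_crossing _ _ _).
  by do 7!case.
move: strip IH.
move: (point_crossing _ _ _) (point_crossing _ _ _) (point_crossing _ _ _).
move: (crossing _ _) (crossing _ _) (chain_crossing _ _ _) (chain_crossing _ _ _).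
by do 7!case.
Qed.

(** Turns crossings of a moving point seen from a fixed one into those of the reversed vector, so
    that both kinds of sides of a rectangle are counted by the same function; the corrections
    telescope to the ends. *)
Lemma chain_pointE (e : R) P Q t : 0 < e ->
  (forall B, B \in Q :: t -> far e P B) -> steps e Q t ->
  chain_crossing Q t P = point_crossing P Q t (+) (upper (P - Q) (+) upper (P - last Q t)).
Proof.
move=> e0; elim: t Q => [|Q' t IH] Q H /=; first by rewrite addbb.
move=> /andP[c ht].
rewrite (IH Q') //; last by move=> B hB; apply: H; rewrite inE hB orbT.
rewrite -(opprB P Q) -(opprB P Q') (crossing_opp e0).
- move: (crossing _ _) (upper _) (upper _) (upper _) (point_crossing _ _ _).
  by do 5!case.
- exact: H (mem_head _ _).
- by apply: H; rewrite !inE eqxx orbT.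
- move: c; rewrite /within_step /= => /andP[c1 c2].
  by apply/andP; split; rewrite -normrN; [move: c1|move: c2];
    congr (`|_| < _); ring.
Qed.

(* The vector from a point of one edge to a point of the other never vanishes,
   so its crossings along the boundary of the product of the two edges cancel. *)
Lemma disjoint_edges (e : R) P s Q t : 0 < e ->
  (forall A B, A \in P :: s -> B \in Q :: t -> far e A B) ->
  steps e P s -> steps e Q t ->
  point_crossing P Q t (+) point_crossing (last P s) Q t
   (+) (point_crossing Q P s (+) point_crossing (last Q t) P s) =
   upper (Q - P) (+) upper (Q - last P s) (+)
   (upper (last Q t - P) (+) upper (last Q t - last P s)).
Proof.
move=> e0 H hs ht; rewrite (rectangle e0 H hs ht).
have far_sym A B : far e A B -> far e B A.
  by rewrite /far -(distrC A.1) -(distrC A.2).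
rewrite !(@chain_pointE e) //.
- move: (upper _) (upper _) (upper _) (upper _) (point_crossing _ _ _) (point_crossing _ _ _).
  by do 6!case.
- by move=> A hA; apply/far_sym/H => //; exact: mem_last.
- by move=> A hA; apply/far_sym/H => //; exact: mem_head.
Qed.

Lemma upper_anti P Q : P != Q -> upper (P - Q) = ~~ upper (Q - P).
Proof.
rewrite /upper /= -(opprB P.1 Q.1) -(opprB P.2 Q.2) !oppr_gt0 oppr_eq0 => PQ.
case: (ltrgt0P (P.2 - Q.2)) => //= /eqP; rewrite subr_eq0 => /eqP PQ2.
case: (ltrgt0P (P.1 - Q.1)) => // /eqP; rewrite subr_eq0 => /eqP PQ1.
by case/eqP: PQ; rewrite (surjective_pairing P) PQ1 PQ2 -surjective_pairing.
Qed.

End ChainParity.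

(* Summing the relations over all pairs of disjoint edges, every [X] occurs twice,
   and so does every [U] up to an odd total number of reversals. *)
Lemma K5_parity (X : nat -> nat -> nat -> bool) (U : nat -> nat -> bool) :
  (forall a b, (a < b < 5)%N -> U b a = ~~ U a b) ->
  (forall i j k l, [&& (i < j < 5)%N, (k < l < 5)%N, i != k, i != l, j != k & j != l] ->
     X i k l (+) X j k l (+) (X k i j (+) X l i j) =
     U k i (+) U k j (+) (U l i (+) U l j)) -> False.
Proof.
move=> anti E.
(* Booleans are used as the field with two elements, where [ring] can sort the long sums below. *)
have {}anti a b : (a < b < 5)%N -> U b a = U a b + 1 :> bool.
  by move=> /anti ->; case: (U a b).
have h0 := E 0 1 2 3 isT. have h1 := E 0 1 2 4 isT. have h2 := E 0 1 3 4 isT.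
have h3 := E 0 2 1 3 isT. have h4 := E 0 2 1 4 isT. have h5 := E 0 2 3 4 isT.
have h6 := E 0 3 1 2 isT. have h7 := E 0 3 1 4 isT. have h8 := E 0 3 2 4 isT.
have h9 := E 0 4 1 2 isT. have h10 := E 0 4 1 3 isT. have h11 := E 0 4 2 3 isT.
have h12 := E 1 2 3 4 isT. have h13 := E 1 3 2 4 isT. have h14 := E 1 4 2 3 isT.
have := f_equal2 addb h0 (f_equal2 addb h1 (f_equal2 addb h2 (f_equal2 addb h3
  (f_equal2 addb h4 (f_equal2 addb h5 (f_equal2 addb h6 (f_equal2 addb h7
  (f_equal2 addb h8 (f_equal2 addb h9 (f_equal2 addb h10 (f_equal2 addb h11
  (f_equal2 addb h12 (f_equal2 addb h13 (h14)))))))))))))).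
rewrite ?(anti 0 2 isT) ?(anti 1 2 isT) ?(anti 0 3 isT) ?(anti 1 3 isT) ?(anti
  0 4 isT) ?(anti 1 4 isT) ?(anti 0 1 isT) ?(anti 2 3 isT) ?(anti 2 4 isT)
  ?(anti 3 4 isT).
set lhs := (X in X = _); set rhs := (X in _ = X).
pose s : bool := X 0 2 3 + X 1 2 3 + X 2 0 1 + X 3 0 1 + X 0 2 4 + X 1 2 4 + X
  4 0 1 + X 0 3 4 + X 1 3 4 + X 0 1 3 + X 2 1 3 + X 1 0 2 + X 3 0 2 + X 0 1 4
  + X 2 1 4 + X 4 0 2 + X 2 3 4 + X 0 1 2 + X 3 1 2 + X 1 0 3 + X 2 0 3 + X 3
  1 4 + X 4 0 3 + X 3 2 4 + X 4 1 2 + X 1 0 4 + X 2 0 4 + X 4 1 3 + X 3 0 4 +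
  X 4 2 3.
pose t : bool := U 0 2 + U 0 2 + U 0 2 + U 1 2 + U 1 2 + U 1 2 + U 0 3 + U 0 3
  + U 0 3 + U 1 3 + U 1 3 + U 1 3 + U 0 4 + U 0 4 + U 0 4 + U 1 4 + U 1 4 + U
  1 4 + U 0 1 + U 0 1 + U 0 1 + U 2 3 + U 2 3 + U 2 3 + U 2 4 + U 2 4 + U 2 4
  + U 3 4 + U 3 4 + U 3 4.
have -> : lhs = (s + s : bool) by rewrite /lhs /s -![addb]/(@GRing.add bool); ring.
(* 45 is the number of reversals over all 15 pairs of disjoint edges; only its being odd matters. *)
have -> : rhs = (t + t + 45%:R : bool) by rewrite /rhs /t -![addb]/(@GRing.add bool); ring.
by case: s t => [] [].
Qed.

Lemma K33_parity (X : nat -> nat -> nat -> bool) (U : nat -> nat -> bool) :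
  (forall a b, (a < b < 6)%N -> U b a = ~~ U a b) ->
  (forall i j k l, [&& (i < 3 <= j)%N, (k < 3 <= l)%N, (j < 6)%N, (l < 6)%N, i != k & j != l] ->
     X i k l (+) X j k l (+) (X k i j (+) X l i j) =
     U k i (+) U k j (+) (U l i (+) U l j)) -> False.
Proof.
move=> anti E.
have {}anti a b : (a < b < 6)%N -> U b a = U a b + 1 :> bool.
  by move=> /anti ->; case: (U a b).
have h0 := E 0 3 1 4 isT. have h1 := E 0 3 1 5 isT. have h2 := E 0 3 2 4 isT.
have h3 := E 0 3 2 5 isT. have h4 := E 0 4 1 3 isT. have h5 := E 0 4 1 5 isT.
have h6 := E 0 4 2 3 isT. have h7 := E 0 4 2 5 isT. have h8 := E 0 5 1 3 isT.
have h9 := E 0 5 1 4 isT. have h10 := E 0 5 2 3 isT. have h11 := E 0 5 2 4 isT.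
have h12 := E 1 3 2 4 isT. have h13 := E 1 3 2 5 isT. have h14 := E 1 4 2 3 isT.
have h15 := E 1 4 2 5 isT. have h16 := E 1 5 2 3 isT. have h17 := E 1 5 2 4 isT.
have := f_equal2 addb h0 (f_equal2 addb h1 (f_equal2 addb h2 (f_equal2 addb h3
  (f_equal2 addb h4 (f_equal2 addb h5 (f_equal2 addb h6 (f_equal2 addb h7
  (f_equal2 addb h8 (f_equal2 addb h9 (f_equal2 addb h10 (f_equal2 addb h11
  (f_equal2 addb h12 (f_equal2 addb h13 (f_equal2 addb h14 (f_equal2 addb h15
  (f_equal2 addb h16 (h17))))))))))))))))).
rewrite ?(anti 0 1 isT) ?(anti 1 3 isT) ?(anti 0 4 isT) ?(anti 3 4 isT) ?(anti
  0 5 isT) ?(anti 3 5 isT) ?(anti 0 2 isT) ?(anti 2 3 isT) ?(anti 1 4 isT)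
  ?(anti 0 3 isT) ?(anti 4 5 isT) ?(anti 2 4 isT) ?(anti 1 5 isT) ?(anti 2 5
  isT) ?(anti 1 2 isT).
set lhs := (X in X = _); set rhs := (X in _ = X).
pose s : bool := X 0 1 4 + X 3 1 4 + X 1 0 3 + X 4 0 3 + X 0 1 5 + X 3 1 5 + X
  5 0 3 + X 0 2 4 + X 3 2 4 + X 2 0 3 + X 0 2 5 + X 3 2 5 + X 0 1 3 + X 4 1 3
  + X 1 0 4 + X 3 0 4 + X 4 1 5 + X 5 0 4 + X 0 2 3 + X 4 2 3 + X 2 0 4 + X 4
  2 5 + X 5 1 3 + X 1 0 5 + X 3 0 5 + X 5 1 4 + X 4 0 5 + X 5 2 3 + X 2 0 5 +
  X 5 2 4 + X 1 2 4 + X 2 1 3 + X 1 2 5 + X 1 2 3 + X 2 1 4 + X 2 1 5.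
pose t : bool := U 0 1 + U 0 1 + U 0 1 + U 1 3 + U 1 3 + U 0 4 + U 0 4 + U 3 4
  + U 3 4 + U 3 4 + U 0 5 + U 0 5 + U 3 5 + U 3 5 + U 3 5 + U 0 2 + U 0 2 + U
  0 2 + U 2 3 + U 2 3 + U 1 4 + U 1 4 + U 0 3 + U 0 3 + U 4 5 + U 4 5 + U 4 5
  + U 2 4 + U 2 4 + U 1 5 + U 1 5 + U 2 5 + U 2 5 + U 1 2 + U 1 2 + U 1 2.
have -> : lhs = (s + s : bool) by rewrite /lhs /s -![addb]/(@GRing.add bool); ring.
have -> : rhs = (t + t + 45%:R : bool) by rewrite /rhs /t -![addb]/(@GRing.add bool); ring.
by case: s t => [] [].
Qed.

(** * Planar drawings *)

From mathcomp Require Import boolp classical_sets set_interval.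
From mathcomp Require Import topology normedtype derive.
Import numFieldNormedType.Exports.

Section ArcChains.
Local Open Scope classical_set_scope.
Variable R : realType.
Implicit Types A B : set (R * R).

Lemma within_step_ball (e : R) (a b : R * R) : ball a e b <-> within_step e a b.
Proof.
rewrite /ball /= /prod_ball /within_step /ball /= -(distrC a.1) -(distrC a.2).
by split => [[? ?]|/andP[]//]; apply/andP.
Qed.

Lemma open_within_step_bigcup (e : R) (B : set (R * R)) :
  open (\bigcup_(z in B) [set w | within_step e z w]).
Proof.
apply: bigcup_open => z _.
suff -> : [set w | within_step e z w] = ball z e by exact: ball_open.
by apply/seteqP; split => w /within_step_ball.
Qed.

(** The points reachable from [a] by chains inside [A] form a subset that is open and closed in [A],
    since one more step absorbs a whole ball. *)
Lemma connected_chain (e : R) A (a b : R * R) : 0 < e -> connected A -> A a -> A b ->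
  exists s, [/\ steps e a s, last a s = b & forall z, z \in a :: s -> A z].
Proof.
move=> e0 cA Aa Ab.
pose B := [set z | A z /\
  exists s, [/\ steps e a s, last a s = z & forall z, z \in a :: s -> A z]].
have step_refl z : within_step e z z by rewrite /within_step !subrr normr0 e0.
have step_sym z w : within_step e z w -> within_step e w z.
  by rewrite /within_step -(distrC z.1) -(distrC z.2).
have grow z w : B z -> A w -> within_step e z w -> B w.
  move=> [Az [s [h1 h2 h3]]] Aw zw; split => //; exists (rcons s w).
  rewrite /steps rcons_path -/(steps e a s) h1 h2 zw last_rcons; split => // y.
  by rewrite -rcons_cons mem_rcons inE => /predU1P[->//|/h3].
suff AB : B = A by have [] : B b by rewrite AB.
apply: cA.
- exists a; split=> //; exists [::]; split => // z.
  by rewrite inE => /eqP ->.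
- exists (\bigcup_(z in B) [set w | within_step e z w]); first exact: open_within_step_bigcup.
  apply/seteqP; split => [z Bz|z [Az [w Bw wz]]]; last exact: grow Bw Az wz.
  by split; [by case: Bz|exists z => //=].
- exists (~` \bigcup_(z in A `\` B) [set w | within_step e z w]).
    exact/open_closedC/open_within_step_bigcup.
  apply/seteqP; split => [z Bz|z [Az nz]].
    split; first by case: Bz.
    move=> [w [Aw nBw] wz]; apply: nBw; by apply: grow Bz Aw _; exact: step_sym.
  by apply: contrapT => nBz; apply: nz; exists z => //=.
Qed.

Lemma compact_far A B : compact A -> compact B -> A `&` B = set0 ->
  exists2 e : R, 0 < e & forall a b, A a -> B b -> far e a b.
Proof.
move=> cA cB AB0.
pose F (z : (R * R) * (R * R)) : R := `|z.1.1 - z.2.1| + `|z.1.2 - z.2.2|.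
have cF : continuous F.
  move=> z.
  apply: (@cvgD R R^o); apply: (@cvg_norm R R^o); apply: (@cvgB R R^o).
  - exact: cvg_comp (cvg_fst : z'.1 @[z' --> z] --> z.1) (cvg_fst : w.1 @[w --> z.1] --> z.1.1).
  - exact: cvg_comp (cvg_snd : z'.2 @[z' --> z] --> z.2) (cvg_fst : w.1 @[w --> z.2] --> z.2.1).
  - exact: cvg_comp (cvg_fst : z'.1 @[z' --> z] --> z.1) (cvg_snd : w.2 @[w --> z.1] --> z.1.2).
  - exact: cvg_comp (cvg_snd : z'.2 @[z' --> z] --> z.2) (cvg_snd : w.2 @[w --> z.2] --> z.2.2).
have cK : compact (F @` (A `*` B)).
  apply: continuous_compact; last exact: compact_setX.
  exact: continuous_subspaceT.
have /closed_openC oK : closed (F @` (A `*` B)).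
  by apply: compact_closed => //; exact: Rhausdorff.
have /oK /nbhs_ballP[d d0 hd] : (~` (F @` (A `*` B))) 0.
  move=> [[a b] [/= Aa Bb]] /eqP; rewrite paddr_eq0 ?normr_ge0 // !normr_eq0 !subr_eq0.
  move=> /andP[/eqP ab1 /eqP ab2].
  rewrite -[False]/(set0 a) -AB0; split => //.
  by rewrite (surjective_pairing a) ab1 ab2 -surjective_pairing.
(* [F] sums both coordinate differences and is at least [d], so one of them is at least [d / 2],
   that is twice this scale. *)
exists (d / 4) => [|a b Aa Bb]; first exact: divr_gt0.
apply: contrapT => /negP; rewrite negb_or -!ltNge => /andP[h1 h2].
have /hd : ball (0 : R) d (F (a, b)).
  by rewrite /ball /= sub0r normrN ger0_norm ?addr_ge0 // /F /=; lra.
by apply; exists (a, b).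
Qed.

End ArcChains.

Section PlanarPaths.
Variables (R : realType) (G : sgraph).

Lemma edge_setP (T : finType) (x y z : T) : reflect (z = x \/ z = y) (z \in [set x; y]%SET).
Proof. by rewrite !inE; apply: (iffP orP) => -[/eqP|/eqP]; auto. Qed.

(** Arcs of disjoint edges are disjoint: a common point would be a vertex lying on both edges. There
    are finitely many pairs of edges, so one scale fits all of them. *)
Lemma planar_edge_chains : planar R G ->
  exists (p : G -> R * R) (e : R) (C : G -> G -> seq (R * R)),
  [/\ injective p, 0 < e,
      forall x y, adj x y -> last (p x) (C x y) = p y /\ steps e (p x) (C x y) &
      forall x y z w, adj x y -> adj z w -> [disjoint [set x; y] & [set z; w]]%SET ->
        forall P Q, P \in p x :: C x y -> Q \in p z :: C z w -> far e P Q].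
Proof.
move=> [p [A [p_inj arcA endA interA]]].
have compA x y : adj x y -> compact (A [set x; y]%SET).
  move=> /arcA[g [cg _ _ _ ->]]; apply: continuous_compact => //.
  exact: segment_compact.
have connA x y : adj x y -> connected (A [set x; y]%SET).
  move=> /arcA[g [cg _ _ _ ->]]; apply: connected_continuous_connected => //.
  exact: segment_connected.
have A_l x y : adj x y -> A [set x; y]%SET (p x).
  by move=> /arcA[g [cg _ <- _ ->]]; exists 0; rewrite //= in_itv /= lexx ler01.
have A_r x y : adj x y -> A [set x; y]%SET (p y).
  by move=> /arcA[g [cg _ _ <- ->]]; exists 1; rewrite //= in_itv /= lexx ler01.
pose indep (t : (G * G) * (G * G)) :=
  [&& adj t.1.1 t.1.2, adj t.2.1 t.2.2 &
   [disjoint [set t.1.1; t.1.2] & [set t.2.1; t.2.2]]%SET].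
have /cid2[f f0 fP] : exists2 f : (G * G) * (G * G) -> R, forall t, 0 < f t &
    forall t, indep t -> forall P Q, A [set t.1.1; t.1.2]%SET P ->
      A [set t.2.1; t.2.2]%SET Q -> far (f t) P Q.
  suff /choice[f fP] : forall t, exists r : R, 0 < r /\ (indep t -> forall P Q, A [set t.1.1;
    t.1.2]%SET P ->
      A [set t.2.1; t.2.2]%SET Q -> far r P Q).
    by exists f => t; have [] := fP t.
  move=> [[x y] [z w]]; have [/and3P[/= xy zw dis]|_] := boolP (indep _); last first.
    by exists 1; split.
  have [|r r0 h] := compact_far (compA _ _ xy) (compA _ _ zw); last by exists r.
  apply/seteqP; split => // P [AP BP].
  have ne : [set x; y]%SET != [set z; w]%SET.
    apply/eqP => eqS; move: dis; rewrite -eqS => /disjointFr/(_ (set21 x y)).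
    by rewrite set21.
  have [v _ pv] := interA _ _ _ _ xy zw ne P (conj AP BP).
  move: AP BP; rewrite -pv => /(endA _ _ _ xy) vx /(endA _ _ _ zw) vz.
  by rewrite (disjointFr dis vx) in vz.
have [e e0 ef] : exists2 e : R, 0 < e & forall t, e <= f t.
  exists (\big[Order.min/1]_t f t) => [|t]; last by rewrite (bigD1 t) //= ge_min lexx.
  by elim/big_ind: _ => // a b a0 b0; rewrite lt_min a0 b0.
have /cid[C CP] : exists C : G -> G -> seq (R * R), forall x y, adj x y ->
    [/\ last (p x) (C x y) = p y, steps e (p x) (C x y) &
        forall P, P \in p x :: C x y -> A [set x; y]%SET P].
  suff : forall t : G * G, exists s, adj t.1 t.2 ->
    [/\ last (p t.1) s = p t.2, steps e (p t.1) s &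
        forall P, P \in p t.1 :: s -> A [set t.1; t.2]%SET P].
    by move=> /choice[C CP]; exists (fun x y => C (x, y)) => x y; exact: (CP (x, y)).
  move=> [x y]; have [/= xy|_] := boolP (adj _ _); last by exists [::].
  by have [s [h1 h2 h3]] := connected_chain e0 (connA _ _ xy) (A_l _ _ xy) (A_r _ _ xy);
    exists s.
exists p, e, C; split=> // [x y /CP[]//|x y z w xy zw dis P Q hP hQ].
have [_ _ /(_ P hP) AP] := CP x y xy; have [_ _ /(_ Q hQ) AQ] := CP z w zw.
have := fP (x, y, (z, w)) _ P Q AP AQ; rewrite /indep /= xy zw dis => /(_ isT).
have := ef (x, y, (z, w)); rewrite /far => h /orP[] h'; apply/orP; [left|right]; lra.
Qed.

(** Edge chains are concatenated along walks. Both walks need an edge, because distances are known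
    only between points of edges. *)
Lemma planar_path_chains : planar R G ->
  exists (p : G -> R * R) (e : R) (D : G -> seq G -> seq (R * R)),
  [/\ injective p, 0 < e,
      forall x q, path (@adj G) x q -> last (p x) (D x q) = p (last x q) /\ steps e (p x) (D x q) &
      forall x q y r, path (@adj G) x q -> path (@adj G) y r -> (0 < size q)%N -> (0 < size r)%N ->
        (forall z, z \in x :: q -> z \notin y :: r) ->
        forall P Q, P \in p x :: D x q -> Q \in p y :: D y r -> far e P Q].
Proof.
move=> /planar_edge_chains[p [e [C [p_inj e0 CE Cfar]]]].
pose fix D x (q : seq G) := if q is y :: q' then C x y ++ D y q' else [::].
have D_edge x q P : path (@adj G) x q -> (0 < size q)%N -> P \in p x :: D x q ->
    exists a b, [/\ adj a b, a \in x :: q, b \in x :: q & P \in p a :: C a b].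
  elim: q x => // y q IH x /= /andP[xy yq] _; rewrite -cat_cons mem_cat.
  case/orP => [hP|]; first by exists x, y; rewrite !inE !eqxx ?orbT.
  case: q IH yq => // z q IH yq hP.
  have [//||a [b [ab aq bq Pab]]] := IH y yq; first by rewrite inE hP orbT.
  by exists a, b; split=> //; rewrite inE ?aq ?bq orbT.
exists p, e, D; split=> // [x q|x q y r xq yr q0 r0 dis P Q hP hQ].
  elim: q x => // y q IH x /= /andP[xy /IH[h1 h2]].
  have [h3 h4] := CE _ _ xy.
  by rewrite last_cat /steps cat_path h3; split => //; rewrite [path _ _ _]h4.
have [a [b [ab aq bq Pab]]] := D_edge _ _ _ xq q0 hP.
have [c [d [cd cr dr Qcd]]] := D_edge _ _ _ yr r0 hQ.
apply: Cfar ab cd _ _ _ Pab Qcd.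
apply/pred0P => z /=; apply/negP => /andP[].
by move=> /edge_setP[]-> /edge_setP[] h; move: (dis _ aq) (dis _ bq); rewrite ?h ?cr ?dr.
Qed.

(** Walks that share an index may meet or overlap arbitrarily; this weak form of a K_5 subdivision
    is available from every K_5 minor. *)
Lemma planar_no_K5_paths : planar R G ->
  ~ exists (v : nat -> G) (q : nat -> nat -> seq G),
    [/\ forall i j, (i < j < 5)%N -> v i != v j,
        forall i j, (i < j < 5)%N -> path (@adj G) (v i) (q i j) /\ last (v i) (q i j) = v j &
        forall i j k l, (i < j < 5)%N -> (k < l < 5)%N -> i != k -> i != l -> j != k -> j != l ->
          forall z, z \in v i :: q i j -> z \notin v k :: q k l].
Proof.
move=> /planar_path_chains[p [e [D [p_inj e0 DE Dfar]]]] [v [q [vv vq dis]]].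
have q0 i j : (i < j < 5)%N -> (0 < size (q i j))%N.
  move=> ij; have [_] := vq i j ij; case: (q i j) => //= h.
  by move: (vv i j ij); rewrite h eqxx.
apply: (@K5_parity (fun a i j => point_crossing (p (v a)) (p (v i)) (D (v i) (q i j)))
                   (fun a b => upper (p (v a) - p (v b)))).
  move=> a b /vv ab; apply: upper_anti; apply: contraNneq ab => /p_inj ->; exact: eqxx.
move=> i j k l /and5P[ij kl ik il /andP[jk jl]].
have [pij lij] := vq _ _ ij; have [pkl lkl] := vq _ _ kl.
have [d1 d2] := DE _ _ pij; have [d3 d4] := DE _ _ pkl.
have := disjoint_edges e0 (Dfar _ _ _ _ pij pkl (q0 _ _ ij) (q0 _ _ kl) (dis _ _ _ _ ij kl ik
  il jk jl)) d2 d4.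
by rewrite d1 d3 lij lkl.
Qed.

Lemma planar_no_K33 : planar R G ->
  ~ exists v : nat -> G,
    (forall i j, (i < j < 6)%N -> v i != v j) /\
    (forall i j, (i < 3 <= j)%N -> (j < 6)%N -> adj (v i) (v j)).
Proof.
move=> /planar_path_chains[p [e [D [p_inj e0 DE Dfar]]]] [v [vv vq]].
apply: (@K33_parity (fun a i j => point_crossing (p (v a)) (p (v i)) (D (v i) [:: v j]))
                   (fun a b => upper (p (v a) - p (v b)))).
  move=> a b /vv ab; apply: upper_anti; apply: contraNneq ab => /p_inj ->; exact: eqxx.
have ne a b : (a < 6)%N -> (b < 6)%N -> a != b -> v a != v b.
  move=> a6 b6; rewrite neq_ltn => /orP[] ab; last rewrite eq_sym.
    by apply: vv; rewrite ab.
  by apply: vv; rewrite ab.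
move=> i j k l /and5P[/andP[i3 j3] /andP[k3 l3] j6 l6 /andP[ik jl]].
have pij : path (@adj G) (v i) [:: v j] by rewrite /= vq // i3.
have pkl : path (@adj G) (v k) [:: v l] by rewrite /= vq // k3.
have [d1 d2] := DE _ _ pij; have [d3 d4] := DE _ _ pkl.
have dis z : z \in [:: v i; v j] -> z \notin [:: v k; v l].
  by rewrite !inE => /orP[]/eqP ->; rewrite !negb_or !ne //; lia.
have := disjoint_edges e0 (Dfar _ _ _ _ pij pkl isT isT dis) d2 d4.
by rewrite d1 d3.
Qed.

End PlanarPaths.

(** * Straight-line drawing of two hubs joined to a path *)

Section Drawing.
Variables (R : realType) (G : sgraph) (u v : G) (idx : G -> nat).
Hypothesis uv : u != v.
Let inner x := (x != u) && (x != v).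
Hypothesis idx_inj : forall x y, inner x -> inner y -> idx x = idx y -> x = y.
Hypothesis idx_adj : forall x y, inner x -> inner y -> adj x y -> consecutive (idx x) (idx y).

(* Straight edges: the hubs are (0, 1) and (0, -1), the other vertices lie on the
   half-line [x > 0, y = 0]. *)
Let pos (x : G) : R * R :=
  if x == u then (0, 1) else if x == v then (0, -1) else ((idx x).+1%:R, 0).
Let sgn (h : G) : R := if h == u then 1 else -1.

Let posu : pos u = (0, 1). Proof. by rewrite /pos eqxx. Qed.
Let posv : pos v = (0, -1). Proof. by rewrite /pos eq_sym (negbTE uv) eqxx. Qed.
Let pos_hub h : ~~ inner h -> pos h = (0, sgn h).
Proof.
rewrite negb_and !negbK /sgn => /orP[]/eqP->; rewrite ?posu ?posv ?eqxx //.
by rewrite eq_sym (negbTE uv).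
Qed.
Let pos_inner x : inner x -> pos x = ((idx x).+1%:R, 0).
Proof. by move=> /andP[/negbTE xu /negbTE xv]; rewrite /pos xu xv. Qed.

Definition segment_set (a b : R * R) : set (R * R) :=
  [set z | exists t : R, [/\ 0 <= t, t <= 1 &
     z = (a.1 + t * (b.1 - a.1), a.2 + t * (b.2 - a.2))]]%classic.

Lemma segment_setC a b : (segment_set a b `<=` segment_set b a)%classic.
Proof.
move=> z [t [t0 t1 ->]]; exists (1 - t); split; [lra|lra|].
by congr (_, _); ring.
Qed.

Lemma is_arc_segment a b : a != b -> is_arc a b (segment_set a b).
Proof.
move=> ab; exists (fun t : R => (a.1 + t * (b.1 - a.1), a.2 + t * (b.2 - a.2))).
have lin (c d : R) : continuous (fun t : R => c + t * d).
  move=> t; apply: (@cvgD R R^o); first exact: cvg_cst.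
  exact: (@cvgM R _ _ _ (fun s : R => s) (fun=> d) _ _ cvg_id (cvg_cst d)).
split; rewrite ?mul0r ?mul1r ?addr0 ?subrKC -?surjective_pairing //.
- by apply: continuous_subspaceT => t; exact: cvg_pair (lin _ _ t) (lin _ _ t).
- move=> s t _ _ [h1 h2]; apply/eqP; rewrite -subr_eq0; apply/eqP.
  have k1 : (s - t) * (b.1 - a.1) = 0 by rewrite mulrBl; lra.
  have k2 : (s - t) * (b.2 - a.2) = 0 by rewrite mulrBl; lra.
  have [//|st0] := eqVneq (s - t) 0; case/eqP: ab.
  move/eqP: k1; move/eqP: k2; rewrite !mulf_eq0 (negbTE st0) /= !subr_eq0 => /eqP e2 /eqP e1.
  by rewrite (surjective_pairing a) (surjective_pairing b) e1 e2.
- apply/seteqP; split => z.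
    by move=> [t [t0 t1 ->]]; exists t; rewrite //= in_itv /= t0.
  by move=> [t /=]; rewrite in_itv /= => /andP[t0 t1] <-; exists t.
Qed.

Let pos_inj : injective pos.
Proof.
move=> x y.
have [xi|xi] := boolP (inner x); have [yi|yi] := boolP (inner y).
- rewrite !pos_inner // => -[/eqP]; rewrite eqr_nat eqSS => /eqP; exact: idx_inj.
- by rewrite (pos_inner xi) (pos_hub yi) => -[/eqP]; rewrite pnatr_eq0.
- by rewrite (pos_inner yi) (pos_hub xi) => -[/eqP]; rewrite eq_sym pnatr_eq0.
- rewrite !pos_hub // => -[]; rewrite /sgn.
  move: xi yi; rewrite !negb_and !negbK => /orP[]/eqP-> /orP[]/eqP-> //;
    by rewrite eqxx [v == u]eq_sym (negbTE uv) => h; exfalso; lra.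
Qed.

(** Coordinates of the points of each kind of edge, with the hub first and the lower index first,
    which spares the cases of orientation. [HubHub] keeps only the vertical line: other edges meet
    it in hubs or not at all. *)
Inductive edge_point (z : R * R) : {set G} -> Prop :=
| HubHub : z.1 = 0 -> edge_point z [set u; v]%SET
| HubInner h w t : ~~ inner h -> inner w -> 0 <= t -> t <= 1 ->
    z = (t * (idx w).+1%:R, sgn h * (1 - t)) -> edge_point z [set h; w]%SET
| InnerInner w w' : inner w -> inner w' -> idx w' = (idx w).+1 -> z.2 = 0 ->
    (idx w).+1%:R <= z.1 -> z.1 <= (idx w).+2%:R -> edge_point z [set w; w']%SET.

Lemma edge_pointP x y z : adj x y -> segment_set (pos x) (pos y) z ->
  edge_point z [set x; y]%SET.
Proof.
have hub_inner h w z' : ~~ inner h -> inner w -> segment_set (pos h) (pos w) z' ->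
    edge_point z' [set h; w]%SET.
  move=> hh wi [t [t0 t1 ->]]; apply: (HubInner hh wi t0 t1).
  by rewrite pos_hub // pos_inner //=; congr (_, _); ring.
have inner_inner w w' z' : inner w -> inner w' -> idx w' = (idx w).+1 ->
    segment_set (pos w) (pos w') z' -> edge_point z' [set w; w']%SET.
  move=> wi wi' ww' [t [t0 t1 ->]].
  have e2 : (idx w).+2%:R = (idx w).+1%:R + 1 :> R by rewrite natr1.
  by apply: (InnerInner wi wi' ww'); rewrite !pos_inner //= ?ww' ?e2; lra.
move=> xy xyz.
have [xi|xi] := boolP (inner x); have [yi|yi] := boolP (inner y).
- have /orP[/eqP h|/eqP h] := idx_adj xi yi xy; first exact: inner_inner.
  by rewrite finset.setUC; apply: inner_inner => //; exact: segment_setC.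
- by rewrite finset.setUC; apply: hub_inner => //; exact: segment_setC.
- exact: hub_inner.
- have -> : [set x; y]%SET = [set u; v]%SET.
    move: xi yi xy; rewrite !negb_and !negbK => /orP[]/eqP-> /orP[]/eqP->;
      by rewrite ?adj_irrefl // finset.setUC.
  by apply: HubHub; have [t [_ _ ->]] := xyz; rewrite !pos_hub //=; ring.
Qed.

Lemma edge_point_vertex c (e : {set G}) : edge_point (pos c) e -> c \in e.
Proof.
have sgnN h : ~~ inner h -> ~~ inner c -> sgn c = sgn h -> c = h.
  by move=> hh cc s; apply: pos_inj; rewrite !pos_hub // s.
case=> {e}.
- move=> z0; have [ci|] := boolP (inner c).
    by move: z0; rewrite pos_inner //= => /eqP; rewrite pnatr_eq0.
  by rewrite negb_and !negbK !inE.
- move=> h w t hh wi t0 t1 E; rewrite !inE; have [ci|ci] := boolP (inner c).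
    move: E; rewrite pos_inner // => -[/eqP E1 /esym/eqP].
    rewrite mulf_eq0 /sgn; case: (h == u); rewrite ?oppr_eq0 oner_eq0 /= subr_eq0 => /eqP t1E;
    by move: E1; rewrite -t1E mul1r eqr_nat eqSS => /eqP /idx_inj-> //; rewrite eqxx orbT.
  move: E; rewrite pos_hub // => -[/esym/eqP]; rewrite mulf_eq0 pnatr_eq0 orbF => /eqP ->.
  by rewrite subr0 mulr1 => /sgnN -> //; rewrite eqxx.
- move=> w w' wi wi' ww' z2 z11 z12; rewrite !inE; have [ci|ci] := boolP (inner c).
    move: z11 z12; rewrite pos_inner //= !ler_nat => h1 h2.
    have [/idx_inj->//|ne] := eqVneq (idx c) (idx w); first by rewrite eqxx.
    by rewrite (@idx_inj c w') ?eqxx ?orbT //; lia.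
  by exfalso; move: z11; rewrite pos_hub //= lern0.
Qed.

Lemma edge_point_cross z (e f : {set G}) : edge_point z e -> edge_point z f -> e != f ->
  exists c, pos c = z.
Proof.
have hub_inner h w t : ~~ inner h -> inner w -> 0 <= t -> t <= 1 -> forall f,
    edge_point (t * (idx w).+1%:R, sgn h * (1 - t)) f -> [set h; w]%SET != f ->
    exists c, pos c = (t * (idx w).+1%:R, sgn h * (1 - t)).
  have sgn0 k : sgn k != 0 by rewrite /sgn; case: (k == u); rewrite ?oppr_eq0 oner_eq0.
  move=> hh wi t0 t1 f'; case=> {f'}.
  - move=> z0 _; exists h; rewrite pos_hub //.
    move: z0 => /= /eqP; rewrite mulf_eq0 pnatr_eq0 orbF => /eqP ->.
    by rewrite mul0r subr0 mulr1.
  - move=> h' w' t' hh' wi' t0' t1' [E1 E2] ne.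
    have [hE|hE] := eqVneq h h'.
      move: ne E1 E2; rewrite -{}hE => ne E1 /(mulfI (sgn0 h)) E2.
      have tt : t' = t by lra.
      rewrite tt in E1 *; have [->|tn0] := eqVneq t 0.
        by exists h; rewrite pos_hub // mul0r subr0 mulr1.
      move/(mulfI tn0)/eqP: E1; rewrite eqr_nat eqSS => /eqP /idx_inj E1.
      by move: ne; rewrite E1 // eqxx.
    have sN : sgn h' = - sgn h.
      move: hh hh' hE; rewrite !negb_and !negbK /sgn => /orP[]/eqP-> /orP[]/eqP->;
        by rewrite ?eqxx // [v == u]eq_sym (negbTE uv) ?opprK.
    (* Edges from opposite hubs lie on opposite sides of the axis, so they can only meet on it, at
       an inner vertex. *)
    have /(mulfI (sgn0 h)) {}E2 : sgn h * (1 - t) = sgn h * - (1 - t') by rewrite E2 sN; ring.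
    have -> : t = 1 by lra.
    by exists w; rewrite pos_inner // mul1r subrr mulr0.
  - move=> a b ai bi ab z2 _ _ _; exists w; rewrite pos_inner //.
    move: z2 => /= /eqP; rewrite mulf_eq0 (negbTE (sgn0 h)) subr_eq0 /= => /eqP <-.
    by rewrite mul1r subrr mulr0.
have hub_hub z' f' : z'.1 = 0 -> edge_point z' f' -> [set u; v]%SET != f' -> exists c, pos c = z'.
  move=> + H; case: H => {f'}.
  - by rewrite eqxx.
  - move=> h w t hh wi t0 t1 -> /= /eqP; rewrite mulf_eq0 pnatr_eq0 orbF => /eqP -> _.
    by exists h; rewrite pos_hub // mul0r subr0 mulr1.
  - by move=> w w' _ _ _ _ h1 _ z0; move: h1; rewrite z0 lern0.
have swap E F : E != F -> F != E by rewrite eq_sym.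
move=> He Hf; case: Hf He => {f} [z1 He|h w t hh wi t0 t1 zE He|w w' wi wi' ww' z2 z11 z12 He].
- by move=> /swap; exact: hub_hub.
- by rewrite zE in He * => /swap; exact: hub_inner He.
case: He (InnerInner wi wi' ww' z2 z11 z12) =>
  {e} [z1 H|h k t hh ki t0 t1 zE H|k k' ki ki' kk' _ z11' z12' _].
- exact: hub_hub H.
- rewrite zE in H *; exact: hub_inner H.
move=> ne; have := le_trans z11 z12'; have := le_trans z11' z12; rewrite !ler_nat => h1 h2.
have zE : z = (z.1, 0) by rewrite -z2 -surjective_pairing.
have [ij|ij|ij] := ltngtP (idx w) (idx k).
- exists k; rewrite pos_inner // zE; congr (_, _); apply: le_anti; rewrite z11' /=.
  by have -> : idx k = (idx w).+1 by lia.
- exists w; rewrite pos_inner // zE; congr (_, _); apply: le_anti; rewrite z11 /=.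
  by have -> : idx w = (idx k).+1 by lia.
- move: ne; rewrite (idx_inj wi ki ij) (idx_inj wi' ki') ?eqxx // ww' kk' ij. by [].
Qed.

Lemma planar_of_index : planar R G.
Proof.
pose A (e : {set G}) := [set z | exists x y : G, [/\ adj x y, e = [set x; y]%SET &
  segment_set (pos x) (pos y) z]]%classic.
have A_point e z : A e z -> edge_point z e.
  by move=> [x [y [xy -> h]]]; exact: edge_pointP.
exists pos, A; split; first exact: pos_inj.
- move=> x y xy; have xneq : x != y by apply: contraTneq xy => ->; rewrite adj_irrefl.
  suff -> : A [set x; y]%SET = segment_set (pos x) (pos y).
    by apply: is_arc_segment; rewrite (inj_eq pos_inj).
  apply/seteqP; split => z; last by move=> h; exists x, y.
  move=> [a [b [ab /setP E]]] h; have := E a; have := E b; have := E x; have := E y.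
  rewrite !inE !eqxx !orbT /= => /esym/orP[]/eqP ya /esym/orP[]/eqP xa _ _; subst.
  - by rewrite eqxx in xneq.
  - exact: segment_setC.
  - by [].
  - by rewrite eqxx in xneq.
- by move=> x y z xy /A_point /edge_point_vertex.
- move=> x y a b xy ab ne z [/A_point h1 /A_point h2].
  by have [c cz] := edge_point_cross h1 h2 ne; exists c.
Qed.

End Drawing.

(** * Spectral radius *)

Section SpectralRadius.
Variables (R : realType) (G : sgraph).
Local Notation e := (@adj G).
Local Notation rho := (spectral_radius R G).
Implicit Types x y : G -> R.

Let of_row (v : 'rV[R]_#|G|) : G -> R := fun a => v ord0 (enum_rank a).
Let to_row (x : G -> R) : 'rV[R]_#|G| := \row_i x (enum_val i).

Lemma continuous_sumR (T : topologicalType) (I : finType) (F : I -> T -> R) :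
  (forall i, continuous (F i)) -> continuous (fun t => \sum_i F i t).
Proof.
move=> cF; apply: continuous_big => // z.
by apply: (@cvgD R R^o); [exact: cvg_fst|exact: cvg_snd].
Qed.

(** The maximum over the unit sphere is attained, as the sphere is closed in the cube of entries
    between -1 and 1; homogeneity extends the bound to all vectors. *)
Lemma rayleigh_max : (0 < #|G|)%N ->
  exists x, sqnorm x = 1 /\ forall y, quad e y <= quad e x * sqnorm y.
Proof.
move=> /card_gt0P[a0 _].
have c_coord a : continuous (fun v => of_row v a).
  by move=> v; exact: coord_continuous.
have c_quad : continuous (fun v => quad e (of_row v)).
  apply: continuous_sumR => a; apply: continuous_sumR => b v.
  apply: (@continuousM R _ (fun v => (e a b)%:R * of_row v a)); last exact: c_coord.
  by apply: (@continuousM R _ (fun=> (e a b)%:R)); [exact: cst_continuous|exact: c_coord].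
have c_norm : continuous (fun v => sqnorm (of_row v)).
  by apply: continuous_sumR => a v; exact: cvgM (c_coord _ _) (c_coord _ _).
have row1 x : of_row (to_row x) = x.
  by apply/funext => a; rewrite /of_row mxE enum_rankK.
pose S := [set v | sqnorm (of_row v) = 1]%classic.
have cS : compact S.
  apply: (@subclosed_compact 'rV[R]_#|G| S
    [set v : 'rV[R]_#|G| | forall i, `[(-1 : R), 1]%classic (v ord0 i)]%classic).
  - apply: (@preimage_closed _ R (fun v => sqnorm (of_row v)) [set 1]%classic);
    first by move=> ? _; exact: c_norm.
    exact: closed_eq.
  - by apply: (@rV_compact R _ (fun=> `[(-1 : R), 1]%classic)) => i; exact: segment_compact.
  - move=> v; rewrite /S /= => v1 i; rewrite in_itv /= -ler_norml.
    rewrite -(@ler_pXn2r _ 2) ?nnegrE // expr1n real_normK ?num_real // -v1.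
    rewrite /sqnorm (bigD1 (enum_val i)) //= /of_row enum_valK lerDl.
    by apply: sumr_ge0 => *; exact: sqr_ge0.
have S0 : (S !=set0)%classic.
  exists (to_row (fun a => (a == a0)%:R)); rewrite /S /= row1 /sqnorm (bigD1 a0) //= eqxx expr1n.
  by rewrite big1 ?addr0 // => a /negbTE ->; rewrite expr0n.
have [v vS vmax] := compact_EVT_max S0 cS (continuous_subspaceT c_quad).
move: vS; rewrite inE => vS; exists (of_row v); split=> // y.
have [y0|y0] := eqVneq (sqnorm y) 0.
  by rewrite y0 mulr0 /quad big1 // => a _; rewrite big1 // => b _; rewrite !(sqnorm_eq0 y0) mulr0.
have yp : 0 < sqnorm y by rewrite lt_def y0 sqnorm_ge0.
pose c := (Num.sqrt (sqnorm y))^-1.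
have c2 : c ^+ 2 = (sqnorm y)^-1 by rewrite exprVn sqr_sqrtr ?ltW.
have := vmax (to_row (fun a => c * y a)); rewrite row1 quadZ c2 mulrC ler_pdivrMr //; apply.
by rewrite inE /S /= row1 sqnormZ c2 mulVf.
Qed.

(** A maximizer of the Rayleigh quotient is an eigenvector, and every eigenvalue is a Rayleigh
    quotient of its own eigenvector; so the supremum of the eigenvalues is this maximum. *)
Lemma spectral_radius_max : (0 < #|G|)%N ->
  exists x, sqnorm x = 1 /\ quad e x = rho /\ forall y, quad e y <= rho * sqnorm y.
Proof.
move=> G0; have [x [x1 xmax]] := rayleigh_max G0.
suff rhoE : rho = quad e x by exists x; rewrite rhoE.
have mulE (v : 'rV[R]_#|G|) i :
    (v *m adjacency_matrix R G) ord0 i = nbr_sum e (of_row v) (enum_val i).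
  rewrite mxE nbr_sumE (reindex (fun i : 'I_#|G| => enum_val i)) /=; last first.
    by exists enum_rank => ? _; rewrite ?enum_valK ?enum_rankK.
  by apply: eq_bigr => j _; rewrite mxE /of_row enum_valK adj_sym mulrC.
have eig : nbr_sum e x =1 (fun a => quad e x * x a).
  by apply: extremal_eigenvector => //; [exact: adj_sym|exact: adj_irrefl|rewrite x1 mulr1].
have row1 y : of_row (to_row y) = y.
  by apply/funext => a; rewrite /of_row mxE enum_rankK.
have in_spec : eigenvalue (adjacency_matrix R G) (quad e x).
  apply/eigenvalueP; exists (to_row x).
    by apply/rowP => i; rewrite mulE row1 eig !mxE.
  apply: contraTneq (oner_neq0 R) => x0; rewrite -x1 -(row1 x) x0 negbK.
  by rewrite /sqnorm big1 // => a _; rewrite /of_row mxE expr0n.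
have ub_spec : ubound [set a | eigenvalue (adjacency_matrix R G) a]%classic (quad e x).
  move=> a /= /eigenvalueP[v vA v0].
  have np : 0 < sqnorm (of_row v).
    rewrite lt_def sqnorm_ge0 andbT; apply: contraNneq v0 => /sqnorm_eq0 h.
    by apply/eqP/rowP => i; have := h (enum_val i); rewrite /of_row enum_valK mxE.
  rewrite -(ler_pM2r np); apply: le_trans (xmax _); rewrite quadE /sqnorm mulr_sumr.
  rewrite le_eqVlt; apply/orP; left; apply/eqP; apply: eq_bigr => b _.
  have := mulE v (enum_rank b); rewrite enum_rankK vA mxE => <-.
  by rewrite -/(of_row v b); ring.
apply/eqP; rewrite eq_le; apply/andP; split; first by apply: ge_sup => //; exists (quad e x).
by apply: ub_le_sup => //; exists (quad e x).
Qed.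

Lemma quad_le_spectral_radius x : (0 < #|G|)%N -> quad e x <= rho * sqnorm x.
Proof. by move=> /spectral_radius_max[y [_ [_]]]; apply. Qed.

(** Absolute values do not lower the quadratic form, so they again give a maximizer and thus an
    eigenvector, which is then divided by its largest entry. *)
Lemma perron_vector : (0 < #|G|)%N ->
  exists x (u : G), [/\ x u = 1, forall a, 0 <= x a, forall a, x a <= 1 &
    forall a, nbr_sum e x a = rho * x a].
Proof.
move=> G0; have [z [z1 [zrho zmax]]] := spectral_radius_max G0.
pose y a := `|z a|.
have y1 : sqnorm y = 1 by rewrite sqnorm_norm.
have yrho : quad e y = rho * sqnorm y.
  by apply: le_anti; rewrite zmax y1 mulr1 -zrho quad_norm.
have eig := extremal_eigenvector (@adj_sym G) (@adj_irrefl G) zmax yrho.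
have /card_gt0P[a0 _] := G0.
pose u := [arg max_(a > a0) y a]%O.
have umax a : y a <= y u by rewrite /u; case: arg_maxP => // i _; apply.
have yu0 : 0 < y u.
  rewrite lt_def normr_ge0 andbT; apply: contraTneq (oner_neq0 R) => yu.
  rewrite negbK -y1 /sqnorm big1 // => a _.
  have : y a = 0 by apply: le_anti; rewrite -{1}yu umax normr_ge0.
  by move=> ->; rewrite expr0n.
exists (fun a => (y u)^-1 * y a), u; split.
- by rewrite mulVf // gt_eqF.
- by move=> a; rewrite mulr_ge0 ?invr_ge0 ?normr_ge0 // ltW.
- by move=> a; rewrite ler_pdivrMl // mulr1.
- move=> a; rewrite /nbr_sum -mulr_sumr mulrCA; congr (_ * _); exact: eig.
Qed.

End SpectralRadius.

(** * Forbidden subgraphs of planar graphs *)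

(* Restores the finite-set names shadowed by [classical_sets]. *)
From mathcomp Require Import fintype finset.
Local Open Scope ring_scope.

Lemma connected_path (T : finType) (e : rel T) (x : T) (s : seq T) :
  symmetric e -> path e x s -> connected_set e [set y in x :: s].
Proof.
move=> e_sym xs; set C := finset _.
have csym : connect_sym (restr e C).
  by apply: sym_connect_sym => a b; rewrite /restr e_sym; case: (a \in C); case: (b \in C).
have path_restr y t : {subset y :: t <= C} -> path e y t -> path (restr e C) y t.
  elim: t y => //= z t IH y sC /andP[yz zt].
  rewrite /restr !sC ?inE ?eqxx ?orbT //= yz; apply: IH zt => w wt.
  by apply: sC; rewrite inE wt orbT.
have from_x w : w \in C -> connect (restr e C) x w.
  rewrite inE; apply: path_connect; apply: path_restr => // y; by rewrite [y \in C]inE.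
by apply/connected_setP => a b aC bC; apply: connect_trans (from_x b bC); rewrite csym;
  exact: from_x.
Qed.

Section PlanarConsequences.
Variables (R : realType) (G : sgraph).
Hypothesis planarG : planar R G.
Local Notation e := (@adj G).

(** Choose a vertex in each branch set and join two of them through an edge between their sets,
    staying in the union of the two; for disjoint pairs of indices these unions are disjoint. *)
Lemma planar_no_K5_minor (Bs : seq {set G}) : size Bs = 5 -> ~~ minor_model e Bs.
Proof.
move=> sz; apply/negP => /andP[/allP nonempty pw].
pose B i := nth set0 Bs i.
have Bin i : (i < 5)%N -> B i \in Bs by move=> i5; rewrite mem_nth ?sz.
have [v0 _] : exists v0, v0 \in B 0.
  by apply/set0Pn; have /andP[] := nonempty _ (Bin 0 isT).
pose v i := odflt v0 [pick x in B i].
have vB i : (i < 5)%N -> v i \in B i.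
  move=> i5; rewrite /v; case: pickP => //= h.
  have /andP[/set0Pn[x xB] _] := nonempty _ (Bin i i5).
  by have := h x; rewrite xB.
have connB i x y : (i < 5)%N -> x \in B i -> y \in B i -> connect (restr e (B i)) x y.
  by move=> i5; have /andP[_ /connected_setP] := nonempty _ (Bin i i5); apply.
have BB i j : (i < j < 5)%N -> [disjoint B i & B j] && touching e (B i) (B j).
  move=> /andP[ij j5]; have /(pairwiseP set0)/(_ i j) := pw.
  by rewrite !inE sz; apply => //; exact: ltn_trans ij j5.
have disB i j : (i < 5)%N -> (j < 5)%N -> i != j -> forall x, x \in B i -> x \notin B j.
  move=> i5 j5; rewrite neq_ltn => /orP[] ij x xB.
    by have /andP[d _] := BB i j ltac:(by rewrite ij); rewrite (disjointFr d xB).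
  by have /andP[d _] := BB j i ltac:(by rewrite ij); rewrite (disjointFl d xB).
have ex_path i j : exists q, (i < j < 5)%N ->
    [/\ path e (v i) q, last (v i) q = v j & {subset v i :: q <= B i :|: B j}].
  have [ij|_] := boolP (i < j < 5)%N; last by exists [::].
  have /andP[ij' j5] := ij; have i5 := ltn_trans ij' j5.
  have /andP[_ /touchingP[a [b [aB bB ab]]]] := BB i j ij.
  have sub k x y : k = i \/ k = j -> restr e (B k) x y -> restr e (B i :|: B j) x y.
    by move=> kk /and3P[xB yB xy]; rewrite /restr !inE; case: kk => <-; rewrite xB yB xy ?orbT.
  have : connect (restr e (B i :|: B j)) (v i) (v j).
    apply: (connect_trans (y := a)).
      apply: connect_sub (connB i _ _ i5 (vB i i5) aB) => x y h.
      by apply: connect1; apply: sub h; left.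
    apply: (connect_trans (y := b)).
      by apply: connect1; rewrite /restr !inE aB bB ab orbT.
    apply: connect_sub (connB j _ _ j5 bB (vB j j5)) => x y h.
    by apply: connect1; apply: sub h; right.
  move=> /connectP[q pq lq]; exists q => _.
  have vi : v i \in B i :|: B j by rewrite inE vB.
  elim: q {lq} (v i) vi pq (esym lq) => [|y q IH] x xB /=.
    by move=> _ h; split=> // z; rewrite inE => /eqP->.
  move=> /andP[/and3P[_ yB xy] yq] lq; have [-> l s] := IH y yB yq lq.
  split; rewrite ?xy // => z; rewrite inE => /predU1P[->//|]; exact: s.
have /boolp.choice[q qP] : forall ij : nat * nat, exists q, (ij.1 < ij.2 < 5)%N ->
    [/\ path e (v ij.1) q, last (v ij.1) q = v ij.2 & {subset v ij.1 :: q <= B ij.1 :|: B ij.2}].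
  by move=> [i j]; exact: ex_path.
apply: (planar_no_K5_paths planarG); exists v, (fun i j => q (i, j)); split.
- move=> i j /andP[ij j5]; have i5 := ltn_trans ij j5.
  apply: contraTneq (vB j j5) => <-; apply: disB (vB i i5) => //; by rewrite ltn_eqF.
- by move=> i j ij; have [? ? _] := qP (i, j) ij.
- move=> i j k l ij kl ik il jk jl z.
  have [_ _ s1] := qP (i, j) ij; have [_ _ s2] := qP (k, l) kl.
  have [i5 j5 k5 l5] : [/\ (i < 5)%N, (j < 5)%N, (k < 5)%N & (l < 5)%N] by split; lia.
  move=> /s1 /= zij; apply/negP => /s2 /=; move: zij.
  rewrite !inE => /orP[] h; by rewrite !(negbTE (disB _ _ _ _ _ _ h)).
Qed.

Lemma planar_degree_sum (S : {set G}) : (degree_sum e S <= 32 * #|S|)%N.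
Proof.
have [->|S0] := eqVneq S set0; first by rewrite /degree_sum big_set0.
rewrite leqNgt; apply/negP => /ltnW /(@mader _ 5 e S (@adj_sym G) (@adj_irrefl G) S0).
by move=> [Bs [sz mBs _]]; have /negP := planar_no_K5_minor sz.
Qed.

Lemma planar_low_degree (S : {set G}) : S != set0 ->
  exists2 x, x \in S & (#|nbr_in e S x| <= 32)%N.
Proof.
move=> S0; apply/exists_inP; rewrite -[X in is_true X]negbK negb_exists_in.
apply/negP => /forall_inP h; have := planar_degree_sum S; rewrite leqNgt => /negP; apply.
rewrite mulnC -sum_nat_const; have /set0Pn[x xS] := S0.
rewrite /degree_sum (bigD1 x) //= [ltnRHS](bigD1 x) //= -addSn; apply: leq_add.
  by rewrite ltnNge; exact: h.
by apply: leq_sum => y /andP[yS _]; apply: ltnW; rewrite ltnNge; exact: h.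
Qed.

Lemma planar_K33 (x y z a b c : G) : uniq [:: x; y; z; a; b; c] ->
  [&& adj x a, adj x b & adj x c] -> [&& adj y a, adj y b & adj y c] ->
  [&& adj z a, adj z b & adj z c] -> False.
Proof.
move=> u /and3P[h1 h2 h3] /and3P[h4 h5 h6] /and3P[h7 h8 h9].
apply: (planar_no_K33 planarG); exists (nth x [:: x; y; z; a; b; c]); split.
  by move=> i j /andP[ij j6]; rewrite nth_uniq //= ?ltn_eqF //; lia.
by case=> [|[|[|i]]] [|[|[|[|[|[|j]]]]]].
Qed.

(** A longer cycle would give a K_5 minor: the two hubs, two successive vertices of the cycle, and
    the remaining arc as one branch set. *)
Lemma planar_hub_cycle (u v : G) (s : seq G) : adj u v -> uniq s -> cycle e s ->
  (forall w, w \in s -> adj u w && adj v w) -> (size s < 3)%N.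
Proof.
move=> uv; case: s => [|a [|b [|c s]]] // us /= cs hub; exfalso.
have irr w : (adj w w) = false := adj_irrefl w.
have hubs w : w \in [:: a, b, c & s] -> [/\ adj u w, adj v w, w != u & w != v].
  move=> /hub /andP[uw vw]; split => //; [apply: contraTneq uw|apply: contraTneq vw] => ->;
  by rewrite irr.
have us' := us; rewrite /= !inE !negb_or in us'.
have /and4P[/and3P[ab ac as_] /andP[bc bs] cns uns] := us'.
pose C := [set x in c :: s].
have /negP := @planar_no_K5_minor [:: [set u]; [set v]; [set a]; [set b]; C] erefl; apply.
have /and4P[eab ebc ecs _] : [&& adj a b, adj b c, path e c (rcons s a) & true] by rewrite andbT.
have conn1 x : connected_set e [set x].
  by apply/connected_setP => ? ? /set1P-> /set1P->; exact: connect0.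
have ne1 (x : G) : [set x] != set0 by apply/set0Pn; exists x; rewrite inE.
have cC : c \in C by rewrite !inE eqxx.
have pcs : path e c s by move: ecs; rewrite rcons_path => /andP[].
have lsa : adj (last c s) a by move: ecs; rewrite rcons_path => /andP[].
have touch1 x y : adj x y -> touching e [set x] [set y].
  by move=> xy; apply/touchingP; exists x, y; rewrite !inE !eqxx.
have touchC x y : adj x y -> y \in C -> touching e [set x] C.
  by move=> xy yC; apply/touchingP; exists x, y; rewrite !inE eqxx; split => //; move: yC;
    rewrite inE.
have inC w : w \in C -> w \in [:: a, b, c & s] by rewrite !inE => ->; rewrite !orbT.
have [ua va au av] := hubs a (mem_head _ _).
have [ub vb bu bv] := hubs b ltac:(by rewrite !inE eqxx orbT).
have [uc vc cu cv] := hubs c ltac:(by rewrite !inE eqxx !orbT).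
have uv' : u != v by apply: contraTneq uv => ->; rewrite irr.
have uC : u \notin C by apply/negP => /inC/hubs[_ _ /eqP].
have vC : v \notin C by apply/negP => /inC/hubs[_ _ _ /eqP].
have aC : a \notin C by rewrite !inE negb_or ac.
have bC : b \notin C by rewrite !inE negb_or bc.
have connC : connected_set e C by exact: connected_path (@adj_sym G) pcs.
have C0 : C != set0 by apply/set0Pn; exists c.
have nin x y : x != y -> x \notin [set y] by rewrite inE.
have al : adj a (last c s) by rewrite adj_sym.
have lC : last c s \in C by rewrite [_ \in C]inE mem_last.
rewrite /minor_model /= !ne1 !conn1 C0 connC /= !disjoints1 uC vC aC bC.
by rewrite !nin ?[u == _]eq_sym ?[v == _]eq_sym // ?[v == u]eq_sym //
  !touch1 // (touchC u c) // (touchC v c) // (touchC b c) // (touchC a _ al lC).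
Qed.

End PlanarConsequences.

(** * Joining two hubs to a linear forest *)

Lemma contains_join (G H : sgraph) (u v : G) (f : H -> G) : adj u v -> injective f ->
  (forall h, adj u (f h) && adj v (f h)) -> (forall h h', adj h h' -> adj (f h) (f h')) ->
  contains G (join (complete_graph 2) H).
Proof.
move=> uv f_inj hub f_adj.
pose g (z : join (complete_graph 2) H) : G :=
  match z with inl i => if i == ord0 then u else v | inr h => f h end.
have fu h : f h != u.
  by have /andP[uf _] := hub h; apply: contraTneq uf => ->; rewrite adj_irrefl.
have fv h : f h != v.
  by have /andP[_ vf] := hub h; apply: contraTneq vf => ->; rewrite adj_irrefl.
have uv' : u != v by apply: contraTneq uv => ->; rewrite adj_irrefl.
have two (i j : 'I_2) : (i == ord0) = (j == ord0) -> i = j.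
  by case: i j => [[|[|i]] hi] [[|[|j]] hj] // _; apply: val_inj.
exists g; split.
  move=> [i|h] [j|h'] /=.
  - move=> E; congr inl; apply: two.
    by move: E; case: (i == ord0); case: (j == ord0) => // /eqP;
      rewrite ?(negbTE uv') // eq_sym (negbTE uv').
  - by case: ifP => _ /eqP; rewrite eq_sym ?(negbTE (fu _)) ?(negbTE (fv _)).
  - by case: ifP => _ /eqP; rewrite ?(negbTE (fu _)) ?(negbTE (fv _)).
  - by move=> /f_inj ->.
move=> [i|h] [j|h'] /=.
- rewrite /complete_adj => ij; have : (i == ord0) != (j == ord0) by apply: contra ij => /eqP/two->.
  by case: (i == ord0); case: (j == ord0) => //; rewrite ?uv // adj_sym.
- by have /andP[uf vf] := hub h'; case: ifP.
- by have /andP[uf vf] := hub h; case: ifP; rewrite adj_sym.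
- exact: f_adj.
Qed.

(* Vertices sent outside [C] are isolated in [H] and can be moved into [C]. *)
Lemma reroute_isolated (H : sgraph) (V : finType) (l : rel V) (C : {set V}) (f : H -> V) :
  (#|H| < #|C|)%N -> (forall a b, l a b -> (a \in C) && (b \in C)) -> injective f ->
  (forall h h', adj h h' -> l (f h) (f h')) ->
  exists f' : H -> V, [/\ injective f', forall h, f' h \in C &
    forall h h', adj h h' -> l (f' h) (f' h')].
Proof.
move=> HC lC; have [m] := ubnP #|[set h | f h \notin C]|.
elim: m f => // m IH f; rewrite ltnS => Sm f_inj f_adj.
have [E|[h0]] := set_0Vmem [set h | f h \notin C].
  exists f; split=> // h; apply/negPn/negP => hC.
  by move/setP/(_ h): E; rewrite !inE hC.
rewrite inE => h0C.
have [r rC rf] : exists2 r, r \in C & r \notin [set f h | h in H].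
  have : ~~ (C \subset [set f h | h in H]).
    apply: contraL HC => /subset_leq_card; rewrite card_imset // -leqNgt; apply.
  by move=> /subsetPn[r rC rf]; exists r.
have iso h : (adj h h0 = false) * (adj h0 h = false).
  have h1 : adj h0 h = false by apply/negP => /f_adj/lC; rewrite (negbTE h0C).
  by rewrite h1 adj_sym h1.
have fr h : f h != r by apply: contraNneq rf => <-; apply: imset_f.
apply: (IH (fun h => if h == h0 then r else f h)).
- apply: leq_trans Sm; apply: proper_card; apply/properP; split.
    by apply/subsetP => h; rewrite !inE; case: eqP => [_|//]; rewrite rC.
  by exists h0; rewrite !inE ?eqxx ?rC.
- move=> h h'; case: eqVneq => [->|_]; case: eqVneq => [->|_] //.
  + by move=> /eqP; rewrite eq_sym (negbTE (fr _)).
  + by move=> /eqP; rewrite (negbTE (fr _)).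
  + exact: f_inj.
- move=> h h'; case: eqVneq => [->|_]; case: eqVneq => [->|_]; rewrite ?iso //.
  exact: f_adj.
Qed.

(** * Admissibility of K_2 + L *)

Section HubGraph.
Variables (V : finType) (u v : V).
Hypothesis uv : u != v.
Local Notation W := (inner_set u v).

Definition hub_graph (l : rel V) (l_sym : symmetric l) : sgraph :=
  SGraph (hub_sym u v l_sym) (hub_irr u v l).

Variables (l : rel V) (l_sym : symmetric l) (l_irr : irreflexive l).

(** The two vertices of K_2 have degree at least 5 in a copy of K_2 + [H], while an inner vertex has
    at most two hubs and two inner neighbours. So they sit on the hubs, and [H] lies in the inner
    part. *)
Lemma hub_graph_free (H : sgraph) : (4 <= #|H|)%N ->
  (forall a, a \in W -> (#|nbr_in l W a| <= 2)%N) ->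
  ~ (exists f : H -> V, [/\ injective f, forall h, f h \in W &
       forall h h', adj h h' -> l (f h) (f h')]) ->
  Defs.free (join (complete_graph 2) H) (hub_graph l_sym).
Proof.
move=> H4 deg noH [f [f_inj f_adj]].
pose h1 := f (inl ord0); pose h2 := f (inl ord_max); pose g h := f (inr h).
have g_inj : injective g by move=> h h' /f_inj [].
have h12 : hub_rel u v l h1 h2 by exact: (f_adj (inl ord0) (inl ord_max)).
have h1g h : hub_rel u v l h1 (g h) by exact: (f_adj (inl ord0) (inr h)).
have h2g h : hub_rel u v l h2 (g h) by exact: (f_adj (inl ord_max) (inr h)).
have key a b : a \in W -> hub_rel u v l a b -> (forall h, hub_rel u v l a (g h)) ->
    (forall h, g h != b) -> False.
  move=> aW ab ag gb.
  have : b |: [set g h | h in H] \subset [set u; v] :|: nbr_in l W a.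
    apply/subsetP => z zA; have : hub_rel u v l a z.
      by case/setU1P: zA => [->//|/imsetP[h _ ->]].
    rewrite /hub_rel aW /= => /andP[_]; rewrite in_setU [z \in nbr_in _ _ _]inE.
    by rewrite inE; case: (z \in [set u; v]).
  move=> /subset_leq_card; rewrite cardsU1 card_imset //.
  have -> : b \notin [set g h | h in H].
    by apply/negP => /imsetP[h _ E]; move: (gb h); rewrite E eqxx.
  move=> h; have := leq_trans h (leq_of_leqif (leq_card_setU _ _)).
  by rewrite cards2 uv; have := deg a aW; move: H4; rewrite cardT; lia.
have [h1W|h1W] := boolP (h1 \in W).
  by apply: (key h1 h2) => // h; apply/eqP => /f_inj.
have [h2W|h2W] := boolP (h2 \in W).
  apply: (key h2 h1) => // [|h]; last by apply/eqP => /f_inj.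
  by rewrite hub_sym.
have gW h : g h \in W.
  have ne i : g h != f (inl i) by apply/eqP => /f_inj.
  have := ne ord0; have := ne ord_max; rewrite -/h1 -/h2.
  have : h1 != h2 by apply/eqP => /f_inj.
  move: h1W h2W; rewrite !inE !negbK => /orP[]/eqP-> /orP[]/eqP->;
    by rewrite ?eqxx // negb_or => _ -> ->.
apply: noH; exists g; split => // h h' hh'.
rewrite -(hub_relW l_irr (gW h) (gW h')); exact: (f_adj (inr h) (inr h')).
Qed.

Lemma hub_graph_planar (R : realType) (idx : V -> nat) : {in W &, injective idx} ->
  (forall a b, a \in W -> b \in W -> l a b -> consecutive (idx a) (idx b)) ->
  planar R (hub_graph l_sym).
Proof.
move=> idx_inj idx_l.
have inW x : (x != u) && (x != v) -> x \in W by rewrite !inE negb_or.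
apply: (@planar_of_index R (hub_graph l_sym) u v idx) => // x y /inW xW /inW yW.
  exact: idx_inj.
by rewrite [adj _ _]hub_relW //; exact: idx_l.
Qed.

Lemma hub_graph_admissible (R : realType) (H : sgraph) (idx : V -> nat) :
  (4 <= #|H|)%N -> {in W &, injective idx} ->
  (forall a b, a \in W -> b \in W -> l a b -> consecutive (idx a) (idx b)) ->
  ~ (exists f : H -> V, [/\ injective f, forall h, f h \in W &
       forall h h', adj h h' -> l (f h) (f h')]) ->
  [/\ #|hub_graph l_sym| = #|V|, planar R (hub_graph l_sym) &
      Defs.free (join (complete_graph 2) H) (hub_graph l_sym)].
Proof.
move=> H4 idx_inj idx_l noH; split=> //; first exact: hub_graph_planar idx_inj idx_l.
apply: hub_graph_free => // a aW; apply: (@consecutive_degree _ _ idx (idx a)).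
  by move=> y z /setIdP[yW _] /setIdP[zW _]; exact: idx_inj.
by move=> y /setIdP[yW ay]; exact: idx_l.
Qed.

End HubGraph.

(** Test vectors with entry 1 on the hubs and [b] elsewhere: [b = 1] shows that [rho] is positive,
    then [b = 2 / rho], the value suggested by the eigenvector equation at an inner vertex, gives
    the bound. *)
Lemma hub_radius_lower (R : realType) (V : finType) (u v : V) (rho : R) : u != v ->
  (forall y : V -> R, quad (hub_rel u v (fun _ _ => false)) y <= rho * sqnorm y) ->
  0 < rho /\ 2 * (#|V|%:R - 2) <= rho ^+ 2.
Proof.
move=> uv ub; set W := inner_set u v; pose m : R := #|W|%:R.
have mE : #|V|%:R = m + 2.
  by rewrite -(cardsC [set u; v]) cards2 uv natrD addrC.
have ubb b : 2 + 4 * (b * m) <= rho * (2 + b ^+ 2 * m).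
  have := ub (fun a => if a \in W then b else 1).
  have uW : (u \in W) = false by rewrite !inE eqxx.
  have vW : (v \in W) = false by rewrite !inE eqxx orbT.
  rewrite quad_hub_rel // /sqnorm (sum_hubs uv) uW vW.
  have q0 (y : V -> R) : quad_in (fun _ _ => false) W y = 0.
    by rewrite /quad_in big1 // => a _; rewrite big1 // => c _; rewrite !mul0r.
  rewrite q0 addr0.
  have const c : \sum_(a in W) (if a \in W then b else 1) ^+ c = b ^+ c * m.
    rewrite (eq_bigr (fun=> b ^+ c)) => [|a ->//]; by rewrite sumr_const mulr_natr.
  have const1 : \sum_(a in W) (if a \in W then b else 1) = b * m := const 1.
  by rewrite const const1 !expr1n !mulr1; lra.
have m0 : 0 <= m by [].
have rho0 : 0 < rho.
  have := ubb 1; rewrite expr1n !mul1r => h; rewrite -(pmulr_lgt0 _ (_ : 0 < 2 + m)); lra.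
split=> //; rewrite mE addrK.
have := ubb (2 / rho); rewrite -(ler_pM2l rho0).
have -> : rho * (2 + 4 * (2 / rho * m)) = 2 * rho + 8 * m by field; rewrite gt_eqF.
have -> : rho * (rho * (2 + (2 / rho) ^+ 2 * m)) = 2 * rho ^+ 2 + 4 * m by field; rewrite gt_eqF.
lra.
Qed.

(** * Extremal graphs *)

Section Induced.
Variables (G : sgraph) (W : {set G}).
Definition induced_adj : rel {w : G | w \in W} := fun a b => adj (val a) (val b).
Fact induced_sym : symmetric induced_adj.
Proof. by move=> a b; rewrite /induced_adj adj_sym. Qed.
Fact induced_irrefl : irreflexive induced_adj.
Proof. by move=> a; rewrite /induced_adj adj_irrefl. Qed.
Definition induced := SGraph induced_sym induced_irrefl.

Lemma join_induced (u v : G) : adj u v -> W = inner_set u v ->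
  (forall w, w \in W -> adj u w && adj v w) ->
  isomorphic G (join (complete_graph 2) induced).
Proof.
move=> uv WE hub; apply: isomorphic_sym.
have uv' : u != v by apply: contraTneq uv => ->; rewrite adj_irrefl.
pose g (z : join (complete_graph 2) induced) : G :=
  match z with inl i => if i == ord0 then u else v | inr w => val w end.
have Wu w : w \in W -> (w == u) = false by rewrite WE !inE negb_or => /andP[/negbTE].
have Wv w : w \in W -> (w == v) = false by rewrite WE !inE negb_or => /andP[_ /negbTE].
have two (i j : 'I_2) : (i == ord0) = (j == ord0) -> i = j.
  by case: i j => [[|[|i]] hi] [[|[|j]] hj] // _; apply: val_inj.
exists g; split.
  pose k (w : G) : join (complete_graph 2) induced :=
    if insub w is Some w' then inr w' else inl (if w == u then ord0 else ord_max).
  exists k => [[i|w]|w] /=.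
  - rewrite /k insubF; last by case: ifP => _; rewrite WE !inE eqxx ?orbT.
    congr inl; apply: two; case: (i == ord0); rewrite ?eqxx //.
    by rewrite [v == u]eq_sym (negbTE uv').
  - by rewrite /k valK.
  - rewrite /k; case: insubP => [w' _ <- //|]; rewrite WE !inE negbK /=.
    by case: eqVneq => [->|_ /=/eqP->] //.
move=> [i|w] [j|w'] //=.
- rewrite /complete_adj; have [->|ij] := eqVneq i j; first by rewrite adj_irrefl.
  have : (i == ord0) != (j == ord0) by apply: contra ij => /eqP/two->.
  by case: (i == ord0); case: (j == ord0) => //; rewrite ?uv // adj_sym.
- by have /andP[a b] := hub _ (valP w'); case: ifP.
- by have /andP[a b] := hub _ (valP w); case: ifP => _; rewrite adj_sym.
Qed.

End Induced.

Section Extremal.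
Variables (R : realType) (H G : sgraph) (n : nat).
Hypothesis H4 : (4 <= #|H|)%N.
Hypothesis H_P4 : contains H (path_graph 4).
Hypothesis G_spex : SPEX_P R n (join (complete_graph 2) H) G.
Local Notation e := (@adj G).
Local Notation rho := (spectral_radius R G).

Let planarG : planar R G. Proof. by case: G_spex => [[]]. Qed.
Let cardG : #|G| = n. Proof. by case: G_spex => [[]]. Qed.
Let freeG : ~ contains G (join (complete_graph 2) H). Proof. by case: G_spex => [[]]. Qed.

(** The only way in which extremality of [G] enters: each admissible K_2 + L placed on the vertices
    of [G] bounds its quadratic form by the spectral radius of [G]. *)
Lemma extremal_quad (u v : G) (l : rel G) (idx : G -> nat) : u != v ->
  symmetric l -> irreflexive l -> {in inner_set u v &, injective idx} ->
  (forall a b, a \in inner_set u v -> b \in inner_set u v -> l a b ->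
     consecutive (idx a) (idx b)) ->
  ~ (exists f : H -> G, [/\ injective f, forall h, f h \in inner_set u v &
       forall h h', adj h h' -> l (f h) (f h')]) ->
  forall y : G -> R, quad (hub_rel u v l) y <= rho * sqnorm y.
Proof.
move=> uv l_sym l_irr idx_inj idx_l noH y.
have [c p f] := hub_graph_admissible uv l_sym l_irr R H4 idx_inj idx_l noH.
have le_rho : spectral_radius R (hub_graph u v l_sym) <= rho.
  by case: G_spex => _; apply; split => //; rewrite c.
have G0 : (0 < #|hub_graph u v l_sym|)%N by rewrite c; apply/card_gt0P; exists u.
apply: le_trans (ler_wpM2r (sqnorm_ge0 y) le_rho).
exact: (quad_le_spectral_radius (G := hub_graph u v l_sym) y G0).
Qed.

Lemma four_path : exists a b c d : H, [/\ uniq [:: a; b; c; d], adj a b, adj b c & adj c d].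
Proof.
case: H_P4 => f [f_inj f_adj].
pose o (i : 'I_4) := f i.
exists (o (inord 0)), (o (inord 1)), (o (inord 2)), (o (inord 3)).
have ne i j : (i < 4)%N -> (j < 4)%N -> i != j -> o (inord i) != o (inord j).
  by move=> i4 j4; apply: contra => /eqP/f_inj/(congr1 val) /=; rewrite !inordK // => ->.
split; try by apply: f_adj; rewrite /= /path_adj !inordK.
by rewrite /= !inE !negb_or !ne.
Qed.

Section Perron.
Variables (x : G -> R) (u : G).
Hypotheses (x0 : forall a, 0 <= x a) (x1 : forall a, x a <= 1) (xu1 : x u = 1).
Hypothesis eig : forall a, nbr_sum e x a = rho * x a.

Let quadG : quad e x = rho * sqnorm x.
Proof. by rewrite quadE /sqnorm mulr_sumr; apply: eq_bigr => a _; rewrite eig; ring. Qed.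

Let C (v : G) := [set w | adj u w && adj v w].

Lemma common_degree v w : u != v -> w \in inner_set u v -> (#|nbr_in e (C v) w| <= 2)%N.
Proof.
rewrite !inE negb_or => uv /andP[wu wv].
rewrite leqNgt; apply/negP => /card_gt2P[a [b [c [[]]]]].
rewrite !inE => /andP[/andP[ua va] wa] /andP[/andP[ub vb] wb] /andP[/andP[uc vc] wc] [ab bc ca].
have irr (z t : G) : adj z t -> z != t by apply: contraTneq => ->; rewrite adj_irrefl.
apply: (planar_K33 planarG (x := u) (y := v) (z := w) (a := a) (b := b) (c := c)).
- by rewrite /= !inE !negb_or uv ![_ == w]eq_sym wu wv ab bc ![_ == c]eq_sym ca !irr // adj_sym.
- by rewrite ua ub uc.
- by rewrite va vb vc.
- by rewrite wa wb wc.
Qed.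

(* Otherwise the hubs would be joined and the rest replaced by copies of [P_3],
   which are free of [P_4]: this gains [2 x_u x_v], close to 2, and loses at most a
   third of the weight of the other vertices, which is about 2. *)
Lemma hubs_adjacent v : u != v -> 9 / 10 <= x v -> 100 <= rho ->
  (forall w, w \in inner_set u v -> x w <= 1 / 100) -> adj u v.
Proof.
move=> uv xv9 rho100 x_small; apply/negPn/negP => nuv.
have [l [idx [l_sym idx_inj l_idx l_weight]]] := triple_layout (inner_set u v) x0.
have l_irr : irreflexive l.
  by move=> a; apply/negP => /l_idx[_ _]; rewrite /consecutive; lia.
have noH : ~ (exists f : H -> G, [/\ injective f, forall h, f h \in inner_set u v &
       forall h h', adj h h' -> l (f h) (f h')]).
  move=> [f [f_inj fW f_adj]]; have [a [b [c [d [us ab bc cd]]]]] := four_path.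
  have [_ _ _ e1] := l_idx _ _ (f_adj _ _ ab); have [_ _ _ e2] := l_idx _ _ (f_adj _ _ bc).
  have [_ _ _ e3] := l_idx _ _ (f_adj _ _ cd).
  have ne h h' : h != h' -> idx (f h) != idx (f h').
    by apply: contra => /eqP/(idx_inj _ _ (fW _) (fW _))/f_inj ->.
  move: us; rewrite /= !inE !negb_or => /and4P[/and3P[/ne ? /ne ? /ne ?] /andP[/ne ? /ne ?]
    /ne ? _].
  lia.
have low := planar_low_degree planarG.
have lt := compare_triples uv (@adj_sym G) (@adj_irrefl G) x0 (fun w => @common_degree v w uv) low
  xu1 (x1 v) xv9 x_small l_sym l_irr rho100 eig nuv (l_weight _ x_small).
have := extremal_quad uv l_sym l_irr idx_inj _ noH x.
by rewrite -quadG leNgt lt => /(_ (fun a b _ _ ab => let: And4 _ _ c _ := l_idx a b ab in c)).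
Qed.

(* Attaching every vertex outside [C v] to both hubs, and to nothing else, gains
   more than the few edges that are removed. *)
Lemma no_exceptional v : adj u v -> 9 / 10 <= x v ->
  (forall w, w \in inner_set u v -> x w <= 1 / 100) -> (#|H| < #|C v|)%N ->
  inner_set u v = C v.
Proof.
move=> auv xv9 x_small HC; set W := inner_set u v.
have uv : u != v by apply: contraTneq auv => ->; rewrite adj_irrefl.
have CW w : w \in C v -> w \in W.
  rewrite !inE negb_or => /andP[uw vw]; apply/andP; split.
    by apply: contraTneq uw => ->; rewrite adj_irrefl.
  by apply: contraTneq vw => ->; rewrite adj_irrefl.
pose l : rel G := fun a b => [&& adj a b, a \in C v & b \in C v].
have l_sym : symmetric l by move=> a b; rewrite /l adj_sym; congr (_ && _); rewrite andbC.
have l_irr : irreflexive l by move=> a; rewrite /l adj_irrefl.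
have l_deg a : (#|[set y | l a y]| <= 2)%N.
  have [aC|aC] := boolP (a \in C v).
    apply: leq_trans (common_degree uv (CW _ aC)); apply: subset_leq_card.
    by apply/subsetP => y; rewrite inE => /and3P[ay _ yC]; rewrite inE yC.
  by rewrite (_ : [set y | l a y] = set0) ?cards0 //; apply/setP => y;
    rewrite !inE /l (negbTE aC) andbF.
have l_acyclic s : uniq s -> cycle l s -> (size s < 3)%N.
  move=> us cs; apply: (planar_hub_cycle planarG auv us).
    by apply: sub_cycle cs => a b /and3P[].
  move=> w ws; have : l w (next s w) := next_cycle cs ws.
  by move=> /and3P[_ + _]; rewrite inE.
have [idx [idx_inj idx_l]] := index_decomposition l_sym l_irr l_deg l_acyclic.
have noH : ~ (exists f : H -> G, [/\ injective f, forall h, f h \in W &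
       forall h h', adj h h' -> l (f h) (f h')]).
  move=> [f [f_inj _ f_adj]].
  have [a b /and3P[_ aC bC]|g [g_inj gC g_adj]] := reroute_isolated (C := C v) HC _ f_inj f_adj.
    by rewrite aC bC.
  apply: freeG; apply: (contains_join auv g_inj) => [h|h h' hh'].
    by have := gC h; rewrite inE.
  by have /and3P[] := g_adj _ _ hh'.
have ub := extremal_quad uv l_sym l_irr (in2W idx_inj) (fun a b _ _ => @idx_l a b) noH.
have low := planar_low_degree planarG.
have lE : quad_in l W x = quad_in e (W :&: C v) x.
  have mk (D : {set G}) (F : G -> R) : \sum_(a in D) F a = \sum_a (a \in D)%:R * F a.
    by rewrite big_mkcond; apply: eq_bigr => a _; case: (a \in D); rewrite ?mul1r ?mul0r.
  rewrite /quad_in !mk; apply: eq_bigr => a _; rewrite !mk !mulr_sumr; apply: eq_bigr => b _.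
  rewrite /l ![_ \in _ :&: _]inE.
  have [aC|aC] := boolP (a \in C v); have [bC|bC] := boolP (b \in C v);
    rewrite ?(CW _ aC) ?(CW _ bC) /= ?andbF ?andbT ?mul0r ?mulr0 ?mul0r ?mulr0 //.
have cmp := compare_common uv (@adj_sym G) (@adj_irrefl G) x0 (fun w => @common_degree v w uv) low
  xu1 xv9 x_small l_sym l_irr auv lE.
set SB := \sum_(w in _) _ in cmp.
have SB0 : 0 <= SB by apply: sumr_ge0.
(* The comparison only shows that exceptional vertices have entry 0. But equality makes [x] an
   eigenvector of the new graph too, where such a vertex is adjacent to [u], of entry 1; so its
   equation fails. *)
have eqq : quad (hub_rel u v l) x = rho * sqnorm x.
  by apply: le_anti; rewrite ub -quadG /=; move: cmp SB0; lra.
have eig' := extremal_eigenvector (hub_sym u v l_sym) (hub_irr u v l) ub eqq.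
have SBE : SB = 0 by move: cmp SB0; rewrite eqq quadG; lra.
apply/setP => w; apply/idP/idP; last exact: CW.
move=> wW; apply/negPn/negP => wC.
have wB : w \in W :\: C v by rewrite inE wC.
have xw0 : x w = 0.
  have /psumr_eq0P : forall a, a \in W :\: C v -> 0 <= x a by move=> a _; exact: x0.
  by move=> /(_ SBE w wB).
have := eig' w; rewrite xw0 mulr0 /nbr_sum (bigD1 u) /=; last first.
  rewrite /hub_rel [u \in _]inE set21 orbT andbT.
  by apply: contraTneq wW => ->; rewrite inE set21.
have : 0 <= \sum_(i | hub_rel u v l w i && (i != u)) x i by apply: sumr_ge0.
rewrite xu1; lra.
Qed.

(** A larger forest without [H] is carried back to the inner vertices through the embedding [g]; all
    old edges survive, and a new edge between positive entries raises the quadratic form beyond the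
    extremal bound. *)
Lemma extremal_maximal v : adj u v -> inner_set u v = C v ->
  maximal_linear_forest H (induced (inner_set u v)).
Proof.
move=> auv WC; have uv : u != v by apply: contraTneq auv => ->; rewrite adj_irrefl.
set W := inner_set u v; rewrite -/W in WC.
have hubW w : w \in W -> adj u w && adj v w by rewrite WC inE.
have W_deg w : w \in W -> (#|nbr_in e W w| <= 2)%N.
  by move=> wW; rewrite WC; exact: common_degree.
split.
- apply: linear_forest_degree_acyclic => [w|s us cs].
    apply: leq_trans (W_deg _ (valP w)); rewrite -(card_imset _ val_inj).
    apply: subset_leq_card; apply/subsetP => _ /imsetP[z + ->].
    by rewrite !inE -[_ || _]negbK -in_set2 => wz; move: (valP z); rewrite /W !inE => ->.
  rewrite -(size_map val); apply: (planar_hub_cycle planarG auv).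
  + by rewrite map_inj_uniq //; exact: val_inj.
  + by rewrite cycle_map.
  + by move=> _ /mapP[z _ ->]; exact: hubW (valP z).
- move=> [f [f_inj f_adj]]; apply: freeG.
  apply: (@contains_join G H u v (fun h => val (f h))) => //.
  + by move=> h h' /val_inj/f_inj.
  + by move=> h; exact: hubW (valP _).
- move=> L L_forest cardL [g [[g_inj g_adj] g_niso]]; apply: boolp.contrapT => noL.
  have [idxL [idxL_inj idxL_adj]] := linear_forest_index L_forest.
  pose l : rel G := fun a b =>
    if insub a is Some a' then if insub b is Some b' then adj (g a') (g b') else false else false.
  pose idx a := if insub a is Some a' then idxL (g a') else 0%N.
  have lE (a b : induced W) : l (val a) (val b) = adj (g a) (g b) by rewrite /l !valK.
  have l_sym : symmetric l.
    by move=> a b; rewrite /l; case: insub => [a'|]; case: insub => [b'|] //; exact: adj_sym.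
  have l_irr : irreflexive l.
    by move=> a; rewrite /l; case: insub => [a'|] //; exact: adj_irrefl.
  have subW a : a \in W -> exists a' : induced W, val a' = a by move=> aW; exists (exist _ a aW).
  have idx_inj : {in W &, injective idx}.
    move=> _ _ /subW[a <-] /subW[b <-]; rewrite /idx !valK => /idxL_inj/g_inj -> //.
  have idx_l a b : a \in W -> b \in W -> l a b -> consecutive (idx a) (idx b).
    by move=> /subW[a' <-] /subW[b' <-]; rewrite lE /idx !valK; exact: idxL_adj.
  have noH : ~ (exists f : H -> G, [/\ injective f, forall h, f h \in W &
       forall h h', adj h h' -> l (f h) (f h')]).
    move=> [f [f_inj fW f_adj]]; apply: noL.
    exists (fun h => g (exist _ (f h) (fW h))); split.
      by move=> h h' /g_inj/(congr1 val)/f_inj.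
    by move=> h h' /f_adj; rewrite -lE.
  have ub := extremal_quad uv l_sym l_irr idx_inj idx_l noH x.
  (* With equal numbers of vertices [g] is bijective, so a proper copy misses an edge. *)
  have [a [b [lab nab]]] : exists a b : induced W, l (val a) (val b) /\ ~~ adj a b.
    apply: boolp.contrapT => none; apply: g_niso; split.
      by apply: inj_card_bij => //; rewrite cardL.
    move=> a b; apply/idP/idP => [gab|]; last exact: g_adj.
    by apply/negPn/negP => nab; apply: none; exists a, b; rewrite lE.
  have xpos w : w \in W -> 0 < x w.
    move=> wW; rewrite lt_def x0 andbT; apply/eqP => xw.
    have := eig w; rewrite xw mulr0 /nbr_sum (bigD1 u) /=; last first.
      by have /andP[uw _] := hubW _ wW; rewrite adj_sym.
    have : 0 <= \sum_(i | e w i && (i != u)) x i by apply: sumr_ge0.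
    rewrite xu1; lra.
  pose h := hub_rel u v l.
  have sub c d : e c d -> h c d.
    move=> cd; rewrite /h /hub_rel -/W; apply/andP; split.
      by apply: contraTneq cd => ->; rewrite adj_irrefl.
    have [/subW[c' cE]|//] := boolP (c \in W); have [/subW[d' dE]|//] := boolP (d \in W).
    by rewrite -cE -dE lE /=; apply: g_adj; rewrite /= /induced_adj cE dE.
  have f0 c d : 0 <= ((h c d)%:R - (e c d)%:R) * x c * x d :> R.
    rewrite !mulr_ge0 // subr_ge0 ler_nat; case ecd : (e c d) => //.
    by rewrite (sub _ _ ecd).
  have diff : quad h x - quad e x = \sum_c \sum_d ((h c d)%:R - (e c d)%:R) * x c * x d.
    rewrite /quad -sumrB; apply: eq_bigr => c _; rewrite -sumrB; apply: eq_bigr => d _.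
    by ring.
  have : 0 < quad h x - quad e x.
    rewrite diff (bigD1 (val a)) //= ltr_pwDl //; last by apply: sumr_ge0 => c _; exact: sumr_ge0.
    rewrite (bigD1 (val b)) //= ltr_pwDl //; last by apply: sumr_ge0.
    have -> : h (val a) (val b).
      by rewrite /h hub_relW //; [exact: valP|exact: valP].
    have -> : e (val a) (val b) = false by apply: negbTE.
    rewrite subr0 mul1r mulr_gt0 //; [exact: xpos (valP a)|exact: xpos (valP b)].
  by rewrite subr_gt0 ltNge quadG ub.
Qed.

Lemma hubs_exist (eta : R) : 0 < eta -> eta <= 10%:R ^- 7 ->
  (1024 / eta ^+ 2) ^+ 2 <= n%:R -> 2 * (32 / eta) ^+ 4 <= eta * n%:R -> 4 <= eta * n%:R ->
  10002 <= n%:R :> R -> 2 * #|H|%:R < n%:R :> R ->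
  exists v, [/\ u != v, 9 / 10 <= x v, 100 <= rho,
    forall w, w \in inner_set u v -> x w <= 1 / 100 & (#|H| < #|C v|)%N].
Proof.
move=> eta0 eta7 n1 n2 n3 n4 nH.
have nE : n%:R = #|G|%:R :> R by rewrite cardG.
have [v0 v0u] : exists v0 : G, u != v0.
  have /subsetPn[v0 _] : ~~ ([set: G] \subset [set u]).
    apply/negP => /subset_leq_card; rewrite cards1 cardsT cardG -(ler_nat R); move: n4; lra.
  by rewrite inE eq_sym => h; exists v0.
pose l0 : rel G := fun _ _ => false.
have noH0 : ~ (exists f : H -> G, [/\ injective f, forall h, f h \in inner_set u v0 &
       forall h h', adj h h' -> l0 (f h) (f h')]).
  by move=> [f [_ _ f_adj]]; have [a [b [c [d [_ /f_adj]]]]] := four_path.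
have rank_inj : {in inner_set u v0 &, injective (fun a : G => nat_of_ord (enum_rank a))}.
  by move=> a b _ _ /ord_inj/enum_rank_inj.
have := hub_radius_lower v0u (@extremal_quad u v0 l0 _ v0u _ _ rank_inj _ noH0).
move=> /(_ _ _ _)[] // rho0; rewrite -nE => rho2.
have rho100 : 100 <= rho.
  rewrite -(@ler_pXn2r _ 2) ?nnegrE ?(ltW rho0) //; apply: le_trans rho2; move: n4; lra.
(* Three common neighbours of three vertices would form a K_{3,3}. *)
have K33 (a b c : G) : a != b -> b != c -> c != a ->
    (#|[set w | [&& e a w, e b w & e c w]]| <= 2)%N.
  move=> ab bc ca; rewrite leqNgt; apply/negP => /card_gt2P[d [f [g [[]]]]].
  rewrite !inE => /and3P[ad bd cd] /and3P[af bf cf] /and3P[ag bg cg] [df fg gd].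
  have irr (z t : G) : adj z t -> z != t by apply: contraTneq => ->; rewrite adj_irrefl.
  apply: (planar_K33 planarG (x := a) (y := b) (z := c) (a := d) (b := f) (c := g)).
  - by rewrite /= !inE !negb_or ab bc [a == c]eq_sym ca df fg [d == g]eq_sym gd !irr.
  - by rewrite ad af ag.
  - by rewrite bd bf bg.
  - by rewrite cd cf cg.
have [v [vu xv cC small]] := two_hubs (@adj_sym G) (planar_degree_sum planarG) K33
  x0 x1 xu1 eig rho0 eta0 nE rho2 n1 n2 n3 eta7.
have CE : [set w | e u w] :&: [set w | e v w] = C v by apply/setP => w; rewrite !inE.
rewrite CE in cC.
have uv : u != v by rewrite eq_sym.
have eta_n : 10%:R ^+ 7 * (eta * n%:R) <= n%:R :> R.
  rewrite mulrA ler_piMl ?ler0n // -ler_pdivlMl ?exprn_gt0 // mulr1. by [].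
exists v; split => // [w wW|].
  move: (wW); rewrite !inE negb_or => /andP[wu wv]; apply: small wu wv _.
  have : [set z | e w z] \subset nbr_in e (C v) w :|: ~: C v.
    apply/subsetP => z; rewrite [z \in [set _ | _]]inE in_setU in_setC [z \in nbr_in _ _ _]inE
      => ->.
    by rewrite andbT orbN.
  move=> /subset_leq_card h; have := leq_trans h (leq_of_leqif (leq_card_setU _ _)).
  have := common_degree uv wW; move=> h1 h2.
  have : #|[set z | e w z]|%:R <= 2 + #|~: C v|%:R :> R.
    by rewrite -[2]/(2%:R) -natrD ler_nat; apply: leq_trans h2 _; rewrite leq_add2r.
  move: cC n3; lra.
rewrite -(ltr_nat R); have : n%:R = #|C v|%:R + #|~: C v|%:R :> R by rewrite -natrD cardsC.
move: cC eta_n nH n4; lra.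
Qed.

End Perron.
End Extremal.

(** A sum of nonnegative terms, one for each lower bound on [n] in [hubs_exist]; exceeding the sum
    meets all of them at once. *)
Definition threshold (R : realType) (eta : R) (k : nat) : R :=
  (1024 / eta ^+ 2) ^+ 2 + 2 * (32 / eta) ^+ 4 / eta + 4 / eta + 10002 + 2 * k%:R.

Lemma threshold_terms (R : realType) (eta : R) (k : nat) : 0 < eta ->
  [/\ 0 <= (1024 / eta ^+ 2) ^+ 2, 0 <= 2 * (32 / eta) ^+ 4 / eta, 0 <= 4 / eta &
      0 <= k%:R :> R].
Proof.
move=> eta0; have e0 := ltW eta0; split; first exact: sqr_ge0.
- by rewrite divr_ge0 // mulr_ge0 // exprn_ge0 // divr_ge0.
- by rewrite divr_ge0.
- exact: ler0n.
Qed.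

Lemma extremal_join (R : realType) (eta : R) (H G : sgraph) (n : nat) :
  0 < eta -> eta <= 10%:R ^- 7 ->
  contains H (path_graph 4) -> threshold eta #|H| < n%:R ->
  SPEX_P R n (join (complete_graph 2) H) G ->
  exists H' : sgraph,
    maximal_linear_forest H H' /\ isomorphic G (join (complete_graph 2) H').
Proof.
move=> eta0 eta7 H_P4 + Gspex; rewrite /threshold.
have [] := threshold_terms #|H| eta0.
set c1 := (1024 / eta ^+ 2) ^+ 2; set c2 := 2 * (32 / eta) ^+ 4 / eta; set c3 := 4 / eta =>
  c1_ge0 c2_ge0 c3_ge0 hH cn.
have H4 : (4 <= #|H|)%N.
  by case: H_P4 => f [f_inj _]; rewrite -[4%N]card_ord; exact: leq_card f_inj.
have cardG : #|G| = n by case: Gspex => [[]].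
have G0 : (0 < #|G|)%N by rewrite cardG -(ltr_nat R); lra.
have [x [u [xu1 x0 x1 eig]]] := perron_vector R G0.
have [|||||v [uv xv rho100 small HC]] :=
    hubs_exist H4 H_P4 Gspex x0 x1 xu1 eig eta0 eta7.
- by rewrite -/c1; lra.
- by rewrite -[X in _ <= X]mulrC -ler_pdivrMr // -/c2; lra.
- by rewrite -[X in _ <= X]mulrC -ler_pdivrMr // -/c3; lra.
- by lra.
- by lra.
have auv := hubs_adjacent H4 H_P4 Gspex x0 x1 xu1 eig uv xv rho100 small.
have WC := no_exceptional H4 Gspex x0 xu1 eig auv xv small HC.
exists (induced (inner_set u v)); split.
  exact: (extremal_maximal H4 Gspex x0 xu1 eig auv WC).
by apply: (join_induced auv) => // w; rewrite WC inE.
Qed.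

Local Close Scope ring_scope.

Theorem theorem1p6 (R : realType) (H : sgraph)
    (H_forest : linear_forest H) (H_P4 : contains H (path_graph 4)) :
  exists N : nat, forall n : nat, N <= n ->
    forall G : sgraph, SPEX_P R n (join (complete_graph 2) H) G ->
      exists H' : sgraph,
        maximal_linear_forest H H' /\ isomorphic G (join (complete_graph 2) H').
Proof.
pose eta : R := (10%:R ^- 7)%R.
have eta0 : (0 < eta)%R by rewrite invr_gt0 exprn_gt0 // ltr0n.
have [h1 h2 h3 h4] := threshold_terms #|H| eta0.
exists (Num.bound (threshold eta #|H|)) => n Nn G.
apply: extremal_join (lexx eta) H_P4 _ => //.
apply: lt_le_trans (archi_boundP _) _; last by rewrite ler_nat.
by rewrite /threshold; lra.
Qed.
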